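(* Let $x\colon[0,\tau]\to M$ be a $C^2$ curve parametrized by arc-length in a surface $M$, with oriented geodesic curvature $k_g(t)$. Then the following are equivalent. (a) Any rolling $q\colon[0,\tau]\to Q$ of $M$ on $\mathbb R^2$ along $x(t)$ has the same initial and final configuration, i.e. $q(0)=q(\tau)$. (b) $x(t)$ is a continuous loop (i.e. $x(0)=x(\tau)$) with trivial holonomy and with geodesic curvature satisfying $$\int_0^\tau\exp\left(i\int_0^tk_g(s)\,ds\right)dt=0,$$ where $i$ is the imaginary unit. Furthermore, a rolling $q(t)$ of $M$ on $\mathbb R^2$ along $x(t)$ is a $C^1$ loop if and only if $x(t)$ satisfies (b) and $\int_0^\tau k_g(t)\,dt=0\ (\mathrm{mod}\ 2\pi)$.
   Context: A surface is a 2-dimensional, connected, oriented Riemannian manifold. $\mathbb R^2$ carries the standard Euclidean structure and orientation. A loop $x$ has trivial holonomy if Levi-Civita parallel transport along $x$ from $T_{x(0)}M$ to $T_{x(\tau)}M=T_{x(0)}M$ is the identity. A $C^1$ curve $q\colon[0,\tau]\to Q$ is a $C^1$ loop if $q(0)=q(\tau)$ and $\dot q(0)=\dot q(\tau)$. Rolling. Let $M,\widehat M$ be connected, oriented Riemannian manifolds of the same dimension $n$ (here $n=2$, $\widehat M=\mathbb R^2$). Let $Q=\{q\in \mathrm{SO}(T_xM,T_{\widehat x}\widehat M): x\in M,\ \widehat x\in\widehat M\}$, where $\mathrm{SO}(V,W)$ is the set of orientation preserving linear isometries between oriented inner product spaces $V$ and $W$; $Q$ is a smooth fiber bundle over $M\times\widehat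 M$, with projections $\pi\colon Q\to M$, $\widehat\pi\colon Q\to\widehat M$. A rolling (without slipping or twisting) of $M$ on $\widehat M$ is an absolutely continuous curve $q\colon[0,\tau]\to Q$ such that, with $x(t)=\pi q(t)$ and $\widehat x(t)=\widehat\pi q(t)$: (I) no slip: $\dot{\widehat x}(t)=q(t)\dot x(t)$ for almost all $t$; (II) no twist: $q(t)\frac{D}{dt}Z(t)=\frac{D}{dt}\big(q(t)Z(t)\big)$ for almost every $t$, for every (absolutely continuous) vector field $Z(t)$ along $x(t)$. Here $\frac{D}{dt}$ is the covariant derivative along the curve for the Levi-Civita connection of the respective manifold. A rolling is ''along $x(t)$'' if $\pi q(t)=x(t)$ for all $t$. Oriented geodesic curvature. For a $C^2$ curve $x(t)$ in a surface, parametrized by arc-length, let $\nu(t)$ be the unique vector field along $x(t)$ such that $\{\dot x(t),\nu(t)\}$ is a positively oriented orthonormal basis for every $t$; then $k_g(t)=\langle\frac{D}{dt}\dot x(t),\nu(t)\rangle$. *)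

(* Defs.v *)
From mathcomp Require Import all_boot all_order all_algebra.
From mathcomp Require Import all_classical all_reals all_analysis.
From mathcomp Require Export complex.

Set Implicit Arguments.
Unset Strict Implicit.
Unset Printing Implicit Defensive.

Import Order.TTheory GRing.Theory Num.Theory.
Import numFieldNormedType.Exports.

Local Open Scope classical_set_scope.
Local Open Scope ring_scope.

(** * Oriented Riemannian manifolds

  Vectors are rows: a linear map acts by [v |-> v *m A], and the Gram matrix
  [g] of an inner product gives [<v, w> = v *m g *m w^T]. *)

Section smooth_maps.
Context {R : realType} {n : nat} {V : normedModType R}.

Fixpoint Ck_on (k : nat) (U : set 'rV[R]_n) (f : 'rV[R]_n -> V) : Prop :=
  match k with
  | 0 => forall p, U p -> {for p, continuous f}
  | k'.+1 => (forall p, U p -> differentiable f p) /\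
             (forall v, Ck_on k' U ('D_v f))
  end.

Definition smooth_on (U : set 'rV[R]_n) (f : 'rV[R]_n -> V) : Prop :=
  forall k, Ck_on k U f.

End smooth_maps.

(** Connected oriented Riemannian manifolds, given by an oriented smooth atlas
    and the Gram matrices of the metric in its charts.  [chart i] and
    [unchart i] are total functions, meaningful only on [dom i] and on
    [chart i @` dom i].  [chart_at] selects a chart around each point. *)
Record riemannian (R : realType) (n : nat) := Riemannian {
  pts :> topologicalType;
  chart_index : Type;
  dom : chart_index -> set pts;
  chart : chart_index -> pts -> 'rV[R]_n;
  unchart : chart_index -> 'rV[R]_n -> pts;
  chart_at : pts -> chart_index;
  metric : chart_index -> 'rV[R]_n -> 'M[R]_n;
  pts_hausdorff : hausdorff_space pts;
  pts_second_countable : @second_countable pts;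
  pts_connected : connected [set: pts];
  dom_chart_at : forall x, dom (chart_at x) x;
  dom_open : forall i, open (dom i);
  chart_open : forall i, open (chart i @` dom i);
  chartK : forall i x, dom i x -> unchart i (chart i x) = x;
  chart_continuous : forall i x, dom i x -> {for x, continuous (chart i)};
  unchart_continuous : forall i p, (chart i @` dom i) p ->
    {for p, continuous (unchart i)};
  transition_smooth : forall i j,
    smooth_on (chart i @` (dom i `&` dom j)) (chart j \o unchart i);
  transition_oriented : forall i j x, dom i x -> dom j x ->
    0 < \det (jacobian (chart j \o unchart i) (chart i x));
  metric_smooth : forall i, smooth_on (chart i @` dom i) (metric i);
  metric_sym : forall i p, (chart i @` dom i) p -> (metric i p)^T = metric i p;
  metric_pos : forall i p, (chart i @` dom i) p -> forall v : 'rV[R]_n,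
    v != 0 -> 0 < (v *m metric i p *m v^T) 0 0;
  metric_transition : forall i j x, dom i x -> dom j x ->
    let J := jacobian (chart j \o unchart i) (chart i x) in
    metric i (chart i x) = J *m metric j (chart j x) *m J^T
}.

Definition surface (R : realType) := riemannian R 2.

Section euclidean_space.
Context (R : realType) (n : nat).
Local Notation E := 'rV[R]_n.

Lemma smooth_cst (V : normedModType R) (U : set E) (c : V) :
  smooth_on U (cst c).
Proof.
move=> k; elim: k c => [|k IH] c /=; first by move=> p _; exact: cst_continuous.
split=> [p _|v]; first exact: differentiable_cst.
rewrite (_ : 'D_v (cst c) = cst 0); first exact: IH.
by apply/funext => p; rewrite derive_cst.
Qed.

Lemma smooth_id (U : set E) : smooth_on U (id : E -> E).
Proof.
case=> [|k] /=; first by move=> p _; exact: cvg_id.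
split=> [p _|v]; first exact: ex_diff.
rewrite (_ : 'D_v (id : E -> E) = cst v); first exact: smooth_cst.
by apply/funext => p; rewrite derive_id.
Qed.

Lemma jacobian_id (p : E) : jacobian (id : E -> E) p = 1%:M.
Proof.
apply/row_matrixP => i; rewrite !rowE -deriveEjacobian; last exact: ex_diff.
by rewrite derive_id mulmx1.
Qed.

Lemma euclidean_second_countable : @second_countable E.
Proof.
pose c (q : 'rV[rat]_n) : E := map_mx ratr q.
pose B : set (set E) :=
  [set ball (c qk.1) (qk.2.+1%:R^-1 : R) | qk in [set: 'rV[rat]_n * nat]].
exists B.
  by apply: card_le_trans (card_image_le _ _) _; exact: countableP.
split=> [_ [[q k] _ <-]|x A /nbhs_ballP[e /= e0 xeA]].
  by apply: ball_open; rewrite invr_gt0.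
have [k ke] : exists k, k.+1%:R^-1 < e / 2 :> R.
  have [//|k] := @ltr_add_invr R 0 (e / 2); first by rewrite divr_gt0.
  by rewrite add0r => ?; exists k.
have k0 : 0 < k.+1%:R^-1 :> R by rewrite invr_gt0.
have [q xq] : exists q, ball (c q) (k.+1%:R^-1 : R) x.
  have /choice[f xf] : forall ij : 'I_1 * 'I_n,
      exists r : rat, `|ratr r - x ij.1 ij.2| < k.+1%:R^-1.
    move=> ij; have : x ij.1 ij.2 - k.+1%:R^-1 < x ij.1 ij.2 + k.+1%:R^-1.
      by rewrite ltrD2l gtrN.
    move=> /rat_in_itvoo[r]; rewrite in_itv/= => /andP[r1 r2]; exists r.
    by rewrite ltr_distl r1 r2.
  exists (\matrix_(i, j) f (i, j)); split=> // i j.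
  by rewrite !mxE; exact: (xf (i, j)).
exists (ball (c q) k.+1%:R^-1); first by split=> //; exists (q, k).
move=> y qy; apply: xeA; rewrite [e]splitr.
by apply: (@ball_triangle _ _ (c q)); apply: (le_ball (ltW ke)) => //;
  exact: ball_sym.
Qed.

Lemma euclidean_connected : connected [set: E].
Proof.
pose seg (x : E) := (fun t : R => t *: x) @` `[0, 1].
rewrite (_ : [set: E] = \bigcup_(x in setT) seg x).
  apply: bigcup_connected => [|x _].
    by exists 0 => x _; exists 0; [rewrite /= in_itv /= lexx ler01|rewrite scale0r].
  apply: connected_continuous_connected; first exact: segment_connected.
  by apply: continuous_subspaceT => t; exact: scalel_continuous.
apply/seteqP; split=> // x _; exists x => //; exists 1; last by rewrite scale1r.
by rewrite /= in_itv /= lexx ler01.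
Qed.

(** The standard structure: a single chart, the identity, and the constant
    metric [1%:M]. *)
Definition euclidean : riemannian R n.
Proof.
refine (@Riemannian R n E unit (fun=> setT) (fun=> id) (fun=> id) (fun=> tt)
  (fun _ _ => 1%:M) _ euclidean_second_countable euclidean_connected
  _ _ _ _ _ _ _ _ _ _ _ _) => //.
- by move=> _; exact: openT.
- by move=> _; rewrite image_id; exact: openT.
- by move=> _ x _; exact: cvg_id.
- by move=> _ x _; exact: cvg_id.
- by move=> _ _; exact: smooth_id.
- by move=> _ _ x _ _; rewrite jacobian_id det1.
- by move=> _; exact: smooth_cst.
- by move=> _ p _; rewrite trmx1.
- move=> _ p _ v v0; rewrite mulmx1 mxE lt_def sumr_ge0 ?andbT; last first.
    by move=> j _; rewrite mxE -expr2 sqr_ge0.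
  apply: contra v0; rewrite psumr_eq0; last first.
    by move=> j _; rewrite mxE -expr2 sqr_ge0.
  move=> /allP h; apply/eqP/rowP => j; rewrite mxE.
  have := h j; rewrite mem_index_enum => /(_ isT) /=.
  by rewrite mxE mulf_eq0 orbb => /eqP.
- by move=> _ _ x _ _ /=; rewrite jacobian_id trmx1 !mulmx1.
Defined.

End euclidean_space.

Definition plane (R : realType) : surface R := euclidean R 2.

(** * Tangent vectors and the Levi-Civita connection

  A vector of [T_x M] is represented by its components in the chart
  [chart_at x], so that [T_x M] is a copy of ['rV[R]_n]. *)

Section tangent.
Context {R : realType} {n : nat} (M : riemannian R n).
Implicit Types (i j : chart_index M) (x : M) (v w : 'rV[R]_n).

Definition transition i j x : 'M[R]_n :=
  jacobian (chart j \o unchart i) (chart i x).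

Definition components i x v : 'rV[R]_n := v *m transition (chart_at x) i x.

Definition gram x : 'M[R]_n := metric (chart_at x) (chart (chart_at x) x).

Definition inner x v w : R := (v *m gram x *m w^T) 0 0.

Definition dmetric i (a b c : 'I_n) (p : 'rV[R]_n) : R :=
  'D_(delta_mx 0 a) (fun p' => metric i p' b c) p.

(** [Gamma^k_(ab)], the Christoffel symbols in the chart [i]. *)
Definition christoffel i (p : 'rV[R]_n) (k a b : 'I_n) : R :=
  2^-1 * \sum_l invmx (metric i p) k l *
    (dmetric i a b l p + dmetric i b a l p - dmetric i l a b p).

Definition christoffel_form i (p v w : 'rV[R]_n) : 'rV[R]_n :=
  \row_k \sum_a \sum_b christoffel i p k a b * v 0 a * w 0 b.

End tangent.

(** * Curves on [[0, tau]]

  Curves are total functions on [R] of which only the restriction to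
  [[0, tau]] matters; derivatives are taken within [[0, tau]], hence are
  one-sided at the end points. *)

Section curves.
Context {R : realType} (tau : R).

Section flat_curves.
Context {V : normedModType R}.
Implicit Types (h : R -> V) (D : set R).

Definition diff_quotient h (t s : R) : V := (s - t)^-1 *: (h s - h t).

Definition derivable_in h (t : R) : Prop :=
  cvg (diff_quotient h t @ within `[0, tau] t^').

Definition der h (t : R) : V :=
  lim (diff_quotient h t @ within `[0, tau] t^').

(** To be used with [D] relatively open in [[0, tau]]. *)
Fixpoint Ck_curve_on (k : nat) D h : Prop :=
  match k with
  | 0 => {within D, continuous h}
  | k'.+1 => (forall t, D t -> derivable_in h t) /\ Ck_curve_on k' D (der h)
  end.

(** Absolute continuity on [[a, b]]; the pairs in [s] are the end points of
    finitely many non-overlapping subintervals. *)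
Definition abs_cont (a b : R) h : Prop :=
  forall e : R, 0 < e -> exists2 d : R, 0 < d & forall s : seq (R * R),
    all (fun I => [&& a <= I.1, I.1 <= I.2 & I.2 <= b]) s ->
    pairwise (fun I J => (I.2 <= J.1) || (J.2 <= I.1)) s ->
    \sum_(I <- s) (I.2 - I.1) < d -> \sum_(I <- s) `|h I.2 - h I.1| < e.

End flat_curves.

(** Regularity of a curve [q] in a space [T] covered by coordinate patches
    [c i : U i -> V]. *)
Section coordinate_curves.
Context {T I : Type} {V : normedModType R}.
Variables (U : I -> set T) (c : I -> T -> V) (q : R -> T).

Definition times i : set R := [set t | t \in `[0, tau] /\ U i (q t)].

Definition Ck_in_coordinates (k : nat) : Prop :=
  forall i, Ck_curve_on k (times i) (c i \o q).

Definition abs_cont_in_coordinates : Prop :=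
  forall i a b, `[a, b] `<=` times i -> abs_cont a b (c i \o q).

End coordinate_curves.

Section manifold_curves.
Context {n : nat} {M : riemannian R n}.
Implicit Types (x : R -> M) (Z : R -> 'rV[R]_n).

Definition Ck_curve (k : nat) x : Prop :=
  {within `[0, tau], continuous x} /\
  Ck_in_coordinates (@dom R n M) (@chart R n M) x k.

Definition differentiable_curve x (t : R) : Prop :=
  derivable_in (chart (chart_at (x t)) \o x) t.

Definition velocity x (t : R) : 'rV[R]_n :=
  der (chart (chart_at (x t)) \o x) t.

Definition arc_length_param x : Prop :=
  forall t, t \in `[0, tau] -> inner (x t) (velocity x t) (velocity x t) = 1.

(** A vector field along [x] is a curve [Z] with [Z t] in [T_(x t) M]; the
    curve [t |-> (x t, Z t)] in [TM] has coordinates over each chart. *)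
Definition abs_cont_field x Z : Prop :=
  abs_cont_in_coordinates
    (fun (i : chart_index M) (xv : M * 'rV[R]_n) => dom i xv.1)
    (fun i xv => row_mx (chart i xv.1) (components i xv.1 xv.2))
    (fun t => (x t, Z t)).

(** [D/dt Z], computed at [t] in the chart [chart_at (x t)]. *)
Definition covariantly_derivable x Z (t : R) : Prop :=
  differentiable_curve x t /\
  derivable_in (fun s => components (chart_at (x t)) (x s) (Z s)) t.

Definition covariant_derivative x Z (t : R) : 'rV[R]_n :=
  let i := chart_at (x t) in
  der (fun s => components i (x s) (Z s)) t +
  christoffel_form i (chart i (x t)) (velocity x t) (Z t).

Definition parallel_field x Z : Prop :=
  abs_cont_field x Z /\
  {ae lebesgue_measure, forall t : R, t \in `[0, tau] ->
    covariantly_derivable x Z t /\ covariant_derivative x Z t = 0}.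

(** The graph of the parallel transport from [T_(x 0) M] to [T_(x tau) M]. *)
Definition parallel_transport x (v w : 'rV[R]_n) : Prop :=
  exists Z, [/\ parallel_field x Z, Z 0 = v & Z tau = w].

(** For a loop, i.e. [x 0 = x tau], both tangent spaces are expressed in the
    same chart. *)
Definition trivial_holonomy x : Prop :=
  forall v w, parallel_transport x v w <-> w = v.

End manifold_curves.

Section geodesic_curvature.
Context {S : surface R}.
Implicit Type x : R -> S.

Definition positive_orthonormal (p : S) (v w : 'rV[R]_2) : Prop :=
  [/\ inner p v v = 1, inner p v w = 0, inner p w w = 1 &
      0 < \det (col_mx v w : 'M[R]_2)].

(** [nu t], unique when [velocity x t] is a unit vector. *)
Definition normal_field x (t : R) : 'rV[R]_2 :=
  xget 0 [set w | positive_orthonormal (x t) (velocity x t) w].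

Definition geodesic_curvature x (t : R) : R :=
  inner (x t) (covariant_derivative x (velocity x) t) (normal_field x t).

End geodesic_curvature.

End curves.

(** * Rolling *)

Section configurations.
Context {R : realType} {n : nat} (M N : riemannian R n).

(** The space [Q] of the orientation preserving isometries
    [T_(foot c) M -> T_(foot' c) N], given by their matrices; orientations are
    compared through the charts, which are all positively oriented. *)
Record configuration := Configuration {
  foot : M;
  foot' : N;
  iso : 'M[R]_n;
  iso_isometry : iso *m gram foot' *m iso^T = gram foot;
  iso_oriented : 0 < \det iso
}.

(** The bundle coordinates of [Q] over the product of two charts. *)
Definition conf_dom (ij : chart_index M * chart_index N) : set configuration :=
  [set c | dom ij.1 (foot c) /\ dom ij.2 (foot' c)].

Definition conf_coord (ij : chart_index M * chart_index N) (c : configuration) :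
    'rV[R]_n * 'rV[R]_n * 'M[R]_n :=
  (chart ij.1 (foot c), chart ij.2 (foot' c),
   transition ij.1 (chart_at (foot c)) (foot c) *m iso c *m
   transition (chart_at (foot' c)) ij.2 (foot' c)).

End configurations.

Section rolling.
Context {R : realType} (tau : R) {n : nat} {M N : riemannian R n}.
Implicit Types (q : R -> configuration M N) (x : R -> M).

Definition continuous_feet q : Prop :=
  {within `[0, tau], continuous (fun t => foot (q t))} /\
  {within `[0, tau], continuous (fun t => foot' (q t))}.

Definition abs_cont_configuration q : Prop :=
  continuous_feet q /\
  abs_cont_in_coordinates tau (@conf_dom R n M N) (@conf_coord R n M N) q.

Definition C1_configuration q : Prop :=
  continuous_feet q /\
  Ck_in_coordinates tau (@conf_dom R n M N) (@conf_coord R n M N) q 1.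

Definition no_slip q : Prop :=
  let x t := foot (q t) in let x' t := foot' (q t) in
  {ae lebesgue_measure, forall t : R, t \in `[0, tau] ->
    [/\ differentiable_curve tau x t, differentiable_curve tau x' t &
        velocity tau x' t = velocity tau x t *m iso (q t)]}.

(** An absolutely continuous [Z] is covariantly derivable at almost every
    [t], so that the premise below excludes a null set only. *)
Definition no_twist q : Prop :=
  let x t := foot (q t) in let x' t := foot' (q t) in
  forall Z : R -> 'rV[R]_n, abs_cont_field tau x Z ->
  let qZ t := Z t *m iso (q t) in
  {ae lebesgue_measure, forall t : R, t \in `[0, tau] ->
    covariantly_derivable tau x Z t ->
    covariantly_derivable tau x' qZ t /\
    covariant_derivative tau x Z t *m iso (q t) =
      covariant_derivative tau x' qZ t}.

Definition rolling q : Prop :=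
  [/\ abs_cont_configuration q, no_slip q & no_twist q].

Definition rolling_along x q : Prop :=
  rolling q /\ forall t, t \in `[0, tau] -> foot (q t) = x t.

(** Once [q 0 = q tau], the derivatives at [0] and [tau] are compared in the
    bundle coordinates around this configuration. *)
Definition C1_loop q : Prop :=
  let h := conf_coord (chart_at (foot (q 0)), chart_at (foot' (q 0))) \o q in
  [/\ C1_configuration q, q 0 = q tau & der tau h 0 = der tau h tau].

End rolling.

(** * Complex integrals *)

Definition expi {R : realType} (theta : R) : R[i] := Complex (cos theta) (sin theta).

Definition complex_integral {R : realType} (a b : R) (f : R -> R[i]) : R[i] :=
  Complex (\int[lebesgue_measure]_(t in `[a, b]) complex.Re (f t))
          (\int[lebesgue_measure]_(t in `[a, b]) complex.Im (f t)).

(* Main.v *)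
(** Let T and nu be the tangent and the unit normal of the curve, so that
    DT = kg nu and Dnu = - kg T, and let phi be the primitive of kg vanishing at
    0.  Rotating (T, nu) by - phi gives a parallel frame E, and
    T = (cos phi, sin phi) E.  A vector field c E is parallel exactly when c is
    constant: c is absolutely continuous and its derivative vanishes almost
    everywhere.  Hence the holonomy is trivial iff E closes up.  A rolling along
    the curve sends parallel fields to parallel fields of the plane, so q E is a
    constant rotation C, and no slip turns the contact point in the plane into
    p0 + (integral of (cos phi, sin phi)) C; conversely these formulas define a
    rolling.  So q closes up iff the curve and E do and the integral of
    exp (i phi) vanishes.  The velocity of q involves phi through
    (cos phi, sin phi) C only, whence the condition phi tau = 0 mod 2 pi.

    That kg does not depend on the chart, hence is continuous, comes down to the
    symmetry of second derivatives of the coordinate changes. *)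

Require Import Defs.
From mathcomp Require Import all_boot all_order all_algebra.
From mathcomp Require Import ring lra.
From mathcomp Require Import all_classical all_reals all_analysis.

Set Implicit Arguments.
Unset Strict Implicit.
Unset Printing Implicit Defensive.

Import Order.TTheory GRing.Theory Num.Theory.
Import numFieldNormedType.Exports.

Local Open Scope classical_set_scope.
Local Open Scope ring_scope.

(** * Derivatives within a segment *)

(** A tangent space is coordinatised by the chart that [chart_at] picks at its point, and this
    choice may jump from point to point. So [velocity], [normal_field] or a frame, read in these
    coordinates, need not be continuous in [t]. Every object along the curve is therefore built in
    each chart [i] separately, differentiated there near a given time, and given a transformation
    law; only chart-free combinations, such as a field times the coframe, are followed over all of
    [[0, tau]]. Absolute continuity likewise is available only while the curve stays in one chart,
    and derivatives are one-sided at the ends. Cousin's lemma passes from local to global without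
    choosing subdivisions: it yields the mean value inequality, boundedness, and constancy from an
    almost everywhere zero derivative. Parallel transport is never solved as a differential
    equation: in dimension two the frame is explicit, and coordinates in it give both existence and
    uniqueness. The inverse metric is kept out of the continuity arguments by lowering the index of
    the connection and by writing the inverse of an orthonormal frame [F] as [G F^T]. *)

Lemma cousin (R : realType) (a b : R) (P : R -> R -> Prop) :
  a <= b ->
  (forall u v w, a <= u -> u <= v -> v <= w -> w <= b ->
    P u v -> P v w -> P u w) ->
  (forall t, a <= t -> t <= b -> exists2 d : R, 0 < d & forall u v,
    a <= u -> u <= t -> t <= v -> v <= b -> t - u < d -> v - t < d -> P u v) ->
  P a b.
Proof.
move=> ab Padd Ploc.
pose S := [set t | [/\ a <= t, t <= b & P a t]].
have Sa : S a.
  split=> //; have [d d0] := Ploc a (lexx _) ab.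
  by apply; rewrite ?lexx ?subrr.
have Sub : ubound S b by move=> t [].
have Ssup : has_sup S by split; [exists a | exists b].
have as_ : a <= sup S by apply: ub_le_sup => //; exists b.
have sb : sup S <= b by apply: ge_sup => //; exists a.
have [d d0 dP] := Ploc _ as_ sb.
have [u [au ub Pau] su] := sup_adherent d0 Ssup.
have us : u <= sup S by apply: ub_le_sup => //; exists b.
(* Locality at [sup S] reaches past it by [d / 2], and [u] joins it to [a]. So [v] belongs to [S]
   and cannot exceed [sup S], which forces [v = b]. *)
pose v := Num.min b (sup S + d / 2).
have vb : v <= b by rewrite /v ge_min lexx.
have sv : sup S <= v by rewrite /v le_min sb lerDl divr_ge0 // ltW.
have Pv : P a v.
  apply: (Padd a u v) => //; first exact: le_trans us sv.
  have vd : v <= sup S + d / 2 by rewrite /v ge_min lexx orbT.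
  by apply: dP => //; lra.
have vs : v <= sup S.
  by apply: ub_le_sup; [exists b | split=> //; exact: le_trans as_ sv].
have ev : v = b.
  case: (leP b (sup S + d / 2)) => [/min_idPl //|h].
  by move: vs; rewrite /v (min_idPr (ltW h)); lra.
by rewrite -ev.
Qed.

Section one_sided_derivative.
Context {R : realType} (tau : R).

(** Little-o form without division: the inequality is trivial at [s = t], and sums, products and
    composites reduce to norm estimates. Uniqueness of [d] is a separate matter: it requires that
    [t] be not isolated in [[0, tau]]. *)
Definition has_der {V : normedModType R} (h : R -> V) (t : R) (d : V) : Prop :=
  forall e, 0 < e -> \forall s \near t, s \in `[0, tau] ->
    `|h s - h t - (s - t) *: d| <= e * `|s - t|.

Section normed_module.
Context {V : normedModType R}.
Implicit Types (f g h : R -> V) (t : R) (d : V).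

Lemma has_der_cvgP h t d : has_der h t d <->
  diff_quotient h t @ within `[0, tau] t^' --> d.
Proof.
have key s : s != t -> `|d - diff_quotient h t s| =
    `|h s - h t - (s - t) *: d| / `|s - t|.
  move=> st; rewrite distrC /diff_quotient.
  have st0 : s - t != 0 by rewrite subr_eq0.
  rewrite -[X in _ - X](@scalerK _ _ (s - t)) // -scalerBr normrZ normfV.
  by rewrite mulrC.
split=> [hd|/cvgrPdist_le hd e e0].
  apply/cvgrPdist_le => e e0; rewrite !near_withinE.
  have := hd e e0; apply: filter_app; near=> s => hs st ss.
  by rewrite key // ler_pdivrMr ?normr_gt0 ?subr_eq0 //; exact: hs.
have := hd e e0; rewrite !near_withinE; apply: filter_app; near=> s => hs ss.
have [->|st] := eqVneq s t; first by rewrite !subrr scale0r !subrr !normr0 mulr0.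
by move: (hs st ss); rewrite key // ler_pdivrMr ?normr_gt0 ?subr_eq0.
Unshelve. all: by end_near. Qed.

Lemma has_der_near_eq f g t d : t \in `[0, tau] ->
  (\forall s \near t, s \in `[0, tau] -> f s = g s) ->
  has_der f t d -> has_der g t d.
Proof.
move=> tI fg fd e e0; have ft := nbhs_singleton fg tI.
have := fd e e0; apply: filter_app; move: fg; apply: filter_app.
by near=> s => fgs fs ss; rewrite -fgs // -ft; exact: fs.
Unshelve. all: by end_near. Qed.

Lemma has_der_eq_in f g t d : t \in `[0, tau] ->
  (forall s : R, s \in `[0, tau] -> f s = g s) -> has_der f t d -> has_der g t d.
Proof.
by move=> tI fg; apply: has_der_near_eq => //; near=> s; exact: fg.
Unshelve. all: by end_near. Qed.

Lemma has_der_bound h t d : has_der h t d ->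
  \forall s \near t, s \in `[0, tau] -> `|h s - h t| <= (`|d| + 1) * `|s - t|.
Proof.
move=> /(_ 1 ltr01); apply: filter_app; near=> s => hs ss.
rewrite -(subrK ((s - t) *: d) (h s - h t)).
apply: le_trans (ler_normD _ _) _; rewrite normrZ mulrDl addrC mulrC.
by apply: lerD => //; exact: hs.
Unshelve. all: by end_near. Qed.

Lemma has_der_continuous h t d : has_der h t d ->
  h @ within `[0, tau] (nbhs t) --> h t.
Proof.
move=> hd; apply/cvgrPdist_le => e e0; rewrite near_withinE.
have c0 : 0 < `|d| + 1 by rewrite ltr_wpDl.
have := has_der_bound hd; apply: filter_app; near=> s => hs ss.
rewrite distrC; apply: le_trans (hs ss) _.
rewrite -ler_pdivlMl // distrC; near: s.
by apply: cvgr_dist_le; [exact: cvg_id | rewrite mulr_gt0 ?invr_gt0].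
Unshelve. all: by end_near. Qed.

Lemma has_der_cst (c : V) t : has_der (cst c) t 0.
Proof.
move=> e e0; near=> s => _; rewrite /= subrr scaler0 subr0 normr0.
by rewrite mulr_ge0 // ltW.
Unshelve. all: by end_near. Qed.

Lemma has_derD f g t d d' : has_der f t d -> has_der g t d' ->
  has_der (fun s => f s + g s) t (d + d').
Proof.
move=> fd gd e e0; have e2 : 0 < e / 2 by rewrite divr_gt0.
have := fd _ e2; apply: filter_app; have := gd _ e2; apply: filter_app.
near=> s => gs fs ss; rewrite scalerDr.
have -> : f s + g s - (f t + g t) - ((s - t) *: d + (s - t) *: d') =
  (f s - f t - (s - t) *: d) + (g s - g t - (s - t) *: d').
  by rewrite !opprD [f s + g s + _]addrACA [LHS]addrACA.
apply: le_trans (ler_normD _ _) _; rewrite [e]splitr mulrDl.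
by apply: lerD; [exact: fs|exact: gs].
Unshelve. all: by end_near. Qed.

Lemma has_der_sum (I : Type) (r : seq I) (f : I -> R -> V) t (d : I -> V) :
  (forall i, has_der (f i) t (d i)) ->
  has_der (fun s => \sum_(i <- r) f i s) t (\sum_(i <- r) d i).
Proof.
move=> fd; elim: r => [|i r IH].
  rewrite big_nil (_ : (fun _ => _) = cst 0); first exact: has_der_cst.
  by apply/funext => s; rewrite big_nil.
rewrite big_cons (_ : (fun _ => _) = fun s => f i s + \sum_(i <- r) f i s).
  exact: has_derD.
by apply/funext => s; rewrite big_cons.
Qed.

Lemma has_der_affine (p v : V) t : has_der (fun s => p + s *: v) t v.
Proof.
move=> e e0; near=> s => _.
rewrite opprD addrACA subrr add0r -scalerBl subrr normr0.
by rewrite mulr_ge0 // ltW.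
Unshelve. all: by end_near. Qed.

End normed_module.

Section composition.
Context {V W : normedModType R}.

Lemma has_der_comp (f : V -> W) (p : R -> V) (t : R) (v : V) :
  differentiable f (p t) -> has_der p t v ->
  has_der (f \o p) t ('d f (p t) v).
Proof.
move=> df pv e e0.
have [k k0 kf] := linear_lipschitz (diff_continuous df).
have c0 : 0 < `|v| + 1 by rewrite ltr_wpDl.
have pc := has_der_continuous pv.
(* The remainder of [f] is charged against |p s - p t| <= (|v| + 1) |s - t|, that of [p] against the
   Lipschitz constant [k] of the differential; each takes half of [e]. *)
have fo : \forall q \near p t,
    `|f q - f (p t) - 'd f (p t) (q - p t)| <= e / 2 / (`|v| + 1) * `|q - p t|.
  have := diff_locally df; move=> /eqaddoP /(_ (e / 2 / (`|v| + 1))).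
  rewrite !divr_gt0 // => /(_ isT) fo.
  have {fo} : \forall q \near (0 : V), `|(f \o shift (p t) -
    (cst (f (p t)) + 'd f (p t))) q| <= e / 2 / (`|v| + 1) * `|q| by exact: fo.
  rewrite (near_shift (p t) 0); apply: filter_app; near=> q.
  by rewrite /= !fctE sub0r subrK opprD addrA.
have e2 : 0 < e / 2 / k by rewrite !divr_gt0.
have fo' : \forall s \near t, s \in `[0, tau] -> `|f (p s) - f (p t) -
    'd f (p t) (p s - p t)| <= e / 2 / (`|v| + 1) * `|p s - p t|.
  exact: (pc _ fo).
have := pv _ e2; apply: filter_app.
have := has_der_bound pv; apply: filter_app.
move: fo'; apply: filter_app; near=> s => /= fs ps pds ss.
have {}fs := fs ss; have {}ps := ps ss; have {}pds := pds ss.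
rewrite -(subrK ('d f (p t) (p s - p t)) (f (p s) - f (p t))) -addrA -linearZ.
rewrite -linearB; apply: le_trans (ler_normD _ _) _.
rewrite [e]splitr mulrDl; apply: lerD.
  apply: le_trans fs _; rewrite -mulrA ler_pM2l ?divr_gt0 //.
  by rewrite ler_pdivrMl.
apply: le_trans (kf _) _.
by rewrite -ler_pdivlMl // mulrA [k^-1 * _]mulrC.
Unshelve. all: by end_near. Qed.

End composition.

Section scalar.
Implicit Types (f g : R -> R) (t : R).

Lemma has_derM f g t a b : has_der f t a -> has_der g t b ->
  has_der (fun s => f s * g s) t (a * g t + f t * b).
Proof.
(* The summands of [c] bound the cofactors of the three errors in the splitting below: |g s| <= |g
   t| + 1, then |f t|, then |a|. *)
move=> fa gb e e0; pose c := `|g t| + 1 + `|f t| + `|a|.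
have c0 : 0 < c by rewrite /c -!addrA ltr_wpDl // ltr_pwDl // addr_ge0.
have ec0 : 0 < e / c by rewrite divr_gt0.
have gc : \forall s \near t, s \in `[0, tau] -> `|g t - g s| <= Num.min 1 (e / c).
  move/cvgrPdist_le: (has_der_continuous gb) => /(_ (Num.min 1 (e / c))).
  by rewrite lt_min ltr01 ec0 near_withinE => /(_ isT).
have := fa _ ec0; apply: filter_app; have := gb _ ec0; apply: filter_app.
move: gc; apply: filter_app; near=> s => gc gs fs ss.
have := gc ss; rewrite distrC le_min => /andP[gc1 gc2].
have gs1 : `|g s| <= `|g t| + 1.
  by rewrite -(subrK (g t) (g s)) (le_trans (ler_normD _ _)) // addrC lerD2l.
have -> : f s * g s - f t * g t - (s - t) *: (a * g t + f t * b) =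
  (f s - f t - (s - t) * a) * g s + (g s - g t - (s - t) * b) * f t +
  (g s - g t) * ((s - t) * a).
  by rewrite -[_ *: _]/(_ * _); ring.
have -> : e * `|s - t| = (e / c * `|s - t|) * (`|g t| + 1) +
  (e / c * `|s - t|) * `|f t| + e / c * (`|s - t| * `|a|).
  by rewrite [e / c * (_ * _)]mulrA -!mulrDr -/c mulrAC divfK ?gt_eqF.
rewrite (le_trans (ler_normD _ _)) // lerD //.
  rewrite (le_trans (ler_normD _ _)) // lerD // normrM ler_pM //.
  - exact: fs.
  - exact: gs.
by rewrite !normrM ler_wpM2r ?mulr_ge0.
Unshelve. all: by end_near. Qed.

End scalar.

End one_sided_derivative.

Section one_sided_limits.
Context {R : realType} (tau : R).
Hypothesis tau_gt0 : 0 < tau.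

(** Properness is what makes [lim], hence [der], meaningful. As [0 < tau], every [t] has neighbours
    in the segment: to its right, or to its left when [t = tau]. *)
Lemma within_punctured_proper (t : R) : t \in `[0, tau] ->
  ProperFilter (within `[0, tau] t^').
Proof.
rewrite in_itv /= => /andP[t0 tt]; apply: Build_ProperFilter_ex => A.
rewrite /within /dnbhs /within /= => /nbhs_ballP[d /= d0 dA].
have [lt|] := ltP t tau.
  exists (Num.min tau (t + d / 2)).
  have st : t < Num.min tau (t + d / 2).
    by rewrite lt_min lt /= ltrDl divr_gt0.
  apply: dA; rewrite /= ?in_itv /= ?gt_eqF //; last first.
    by rewrite ge_min lexx ltW // (le_lt_trans t0 st).
  rewrite /ball /= distrC ger0_norm; last by rewrite subr_ge0 ltW.
  rewrite ltrBlDl gt_min; apply/orP; right; lra.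
move=> /(conj tt)/andP/le_anti et; exists (Num.max 0 (t - d / 2)).
have st : Num.max 0 (t - d / 2) < t.
  by rewrite gt_max et tau_gt0 ltrBlDl ltrDr divr_gt0.
apply: dA; rewrite /= ?in_itv /= ?lt_eqF //; last first.
  by rewrite le_max lexx /= ltW // (lt_le_trans st tt).
rewrite /ball /= ger0_norm; last by rewrite subr_ge0 ltW.
rewrite ltrBlDr -ltrBlDl lt_max; apply/orP; right; lra.
Qed.

Section normed_module.
Context {V : normedModType R}.
Implicit Types (h : R -> V) (t : R).

Lemma has_derE h t d : t \in `[0, tau] -> has_der tau h t d ->
  derivable_in tau h t /\ der tau h t = d.
Proof.
move=> tI /has_der_cvgP hd; have PF := within_punctured_proper tI.
by split; [apply/cvg_ex; exists d | exact: cvg_lim].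
Qed.

Lemma derivable_inP h t :
  derivable_in tau h t -> has_der tau h t (der tau h t).
Proof. by move=> hd; apply/has_der_cvgP. Qed.

Lemma has_der_unique h t d d' : t \in `[0, tau] ->
  has_der tau h t d -> has_der tau h t d' -> d = d'.
Proof. by move=> tI /(has_derE tI)[_ <-] /(has_derE tI)[_ <-]. Qed.

End normed_module.

End one_sided_limits.

(** * Derivatives and continuity of matrix-valued curves, entry by entry *)

Section matrix_valued.
Context {R : realType} (tau : R).

Lemma mx_norm_leP m n (A : 'M[R]_(m, n)) (e : R) : 0 <= e ->
  (`|A| <= e) <-> (forall i j, `|A i j| <= e).
Proof.
move=> e0; have -> : `|A| = \big[Num.max/0]_ij `|A ij.1 ij.2|.
  by rewrite [LHS]/Num.Def.normr /= mx_normrE.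
split=> [+ i j|h]; first by move/bigmax_leP => [_ /(_ (i, j))]; apply.
by apply/bigmax_leP; split => // -[i j] _ /=.
Qed.

Lemma near_ord2 m n (P : 'I_m -> 'I_n -> R -> Prop) (t : R) :
  (forall i j, \forall s \near t, P i j s) ->
  \forall s \near t, forall i j, P i j s.
Proof.
move=> h; apply: (@filter_forall _ _ (fun i s => forall j, P i j s) (nbhs t) _).
by move=> i; apply: (@filter_forall _ _ (P i) (nbhs t) _); exact: h.
Qed.

Lemma has_der_mxP m n (A : R -> 'M[R]_(m, n)) t D :
  has_der tau A t D <-> (forall i j, has_der tau (fun s => A s i j) t (D i j)).
Proof.
split=> [h i j e e0|h e e0].
  have := h e e0; apply: filter_app; near=> s => hs ss.
  have := hs ss; rewrite mx_norm_leP ?mulr_ge0 ?(ltW e0) // => /(_ i j).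
  by rewrite !mxE.
have : \forall s \near t, forall i j, s \in `[0, tau] ->
    `|A s i j - A t i j - (s - t) *: D i j| <= e * `|s - t|.
  apply: (@near_ord2 _ _ (fun i j s => s \in `[0, tau] ->
    `|A s i j - A t i j - (s - t) *: D i j| <= e * `|s - t|)) => i j; exact: h.
apply: filter_app; near=> s => hs ss.
rewrite mx_norm_leP ?mulr_ge0 ?(ltW e0) // => i j.
by rewrite !mxE; exact: hs.
Unshelve. all: by end_near. Qed.

Lemma has_der_mulmx m n p (A : R -> 'M[R]_(m, n)) (B : R -> 'M[R]_(n, p)) t A' B' :
  has_der tau A t A' -> has_der tau B t B' ->
  has_der tau (fun s => A s *m B s) t (A' *m B t + A t *m B').
Proof.
move=> /has_der_mxP hA /has_der_mxP hB; apply/has_der_mxP => i j.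
rewrite (_ : (fun s => _) = fun s => \sum_k A s i k * B s k j); last first.
  by apply/funext => s; rewrite mxE.
by rewrite !mxE -big_split; apply: has_der_sum => k; exact: has_derM.
Qed.

Lemma has_der_mulmxl m n p (C : 'M[R]_(m, n)) (B : R -> 'M[R]_(n, p)) t B' :
  has_der tau B t B' -> has_der tau (fun s => C *m B s) t (C *m B').
Proof.
move=> hB; rewrite -[C *m B']add0r -(mul0mx _ (B t)).
exact: has_der_mulmx (has_der_cst tau C t) hB.
Qed.

Lemma has_der_mulmxr m n p (A : R -> 'M[R]_(m, n)) (C : 'M[R]_(n, p)) t A' :
  has_der tau A t A' -> has_der tau (fun s => A s *m C) t (A' *m C).
Proof.
move=> hA; rewrite -[A' *m C]addr0 -(mulmx0 _ (A t)).
exact: has_der_mulmx hA (has_der_cst tau C t).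
Qed.

Lemma has_der_trmx m n (A : R -> 'M[R]_(m, n)) t A' :
  has_der tau A t A' -> has_der tau (fun s => (A s)^T) t A'^T.
Proof.
move=> /has_der_mxP hA; apply/has_der_mxP => i j.
rewrite mxE (_ : (fun s => _) = fun s => A s j i) //.
by apply/funext => s; rewrite mxE.
Qed.

Lemma has_der_scalemx m n (f : R -> R) (A : R -> 'M[R]_(m, n)) t f' A' :
  has_der tau f t f' -> has_der tau A t A' ->
  has_der tau (fun s => f s *: A s) t (f' *: A t + f t *: A').
Proof.
move=> hf /has_der_mxP hA; apply/has_der_mxP => i j; rewrite !mxE.
rewrite (_ : (fun s => _) = fun s => f s * A s i j); first exact: has_derM.
by apply/funext => s; rewrite mxE.
Qed.

Lemma has_der_pair (V W : normedModType R) (f : R -> V) (g : R -> W) t d d' :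
  has_der tau f t d -> has_der tau g t d' ->
  has_der tau (fun s => (f s, g s)) t (d, d').
Proof.
move=> fd gd e e0; have := fd e e0; apply: filter_app.
have := gd e e0; apply: filter_app; near=> s => gs fs ss.
by rewrite prod_normE /= ge_max fs //= gs.
Unshelve. all: by end_near. Qed.

Definition cont_in {T : topologicalType} (h : R -> T) (t : R) :=
  h @ within `[0, tau] (nbhs t) --> h t.

Section cont_in.
Implicit Types t : R.

Lemma cont_inP (V : normedModType R) (h : R -> V) t :
  cont_in h t <-> forall e, 0 < e ->
    \forall s \near t, s \in `[0, tau] -> `|h s - h t| <= e.
Proof.
split=> [/cvgrPdist_le h' e e0|h'].
  have := h' e e0; rewrite near_withinE; apply: filter_app.
  by near=> s => + ss => /(_ ss); rewrite distrC.
apply/cvgrPdist_le => e e0; rewrite near_withinE; have := h' e e0.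
by apply: filter_app; near=> s => + ss => /(_ ss); rewrite distrC.
Unshelve. all: by end_near. Qed.

Lemma cont_in_near (V : topologicalType) (f g : R -> V) t : t \in `[0, tau] ->
  (\forall s \near t, s \in `[0, tau] -> f s = g s) ->
  cont_in f t -> cont_in g t.
Proof.
move=> tI fg; have ft := nbhs_singleton fg tI.
rewrite /cont_in -ft; apply: cvg_trans; apply: near_eq_cvg.
by rewrite near_withinE; apply: filter_app fg; near=> s => fg ss; rewrite fg.
Unshelve. all: by end_near. Qed.

Lemma cont_in_mxP m n (A : R -> 'M[R]_(m, n)) t :
  cont_in A t <-> forall i j, cont_in (fun s => A s i j) t.
Proof.
split=> [/cont_inP h i j|h].
  apply/cont_inP => e e0; have := h e e0; apply: filter_app.
  near=> s => hs ss; have := hs ss; rewrite mx_norm_leP ?(ltW e0) // => /(_ i j).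
  by rewrite !mxE.
apply/cont_inP => e e0.
have : \forall s \near t, forall i j, s \in `[0, tau] -> `|A s i j - A t i j| <= e.
  apply: (@near_ord2 _ _ (fun i j s => s \in `[0, tau] ->
    `|A s i j - A t i j| <= e)) => i j.
  by move/cont_inP: (h i j); exact.
apply: filter_app; near=> s => hs ss.
by rewrite mx_norm_leP ?(ltW e0) // => i j; rewrite !mxE; exact: hs.
Unshelve. all: by end_near. Qed.

Lemma cont_in_mulmx m n p (A : R -> 'M[R]_(m, n)) (B : R -> 'M[R]_(n, p)) t :
  cont_in A t -> cont_in B t -> cont_in (fun s => A s *m B s) t.
Proof.
move=> /cont_in_mxP hA /cont_in_mxP hB; apply/cont_in_mxP => i j.
rewrite (_ : (fun s => _) = fun s => \sum_k A s i k * B s k j); last first.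
  by apply/funext => s; rewrite mxE.
rewrite /cont_in /=.
elim: (index_enum _) => [|k r IH].
  under eq_fun do rewrite big_nil.
  by rewrite big_nil; exact: cvg_cst.
under eq_fun do rewrite big_cons.
by rewrite big_cons; apply: cvgD => //; apply: cvgM; [exact: hA|exact: hB].
Qed.

Lemma cont_in_trmx m n (A : R -> 'M[R]_(m, n)) t :
  cont_in A t -> cont_in (fun s => (A s)^T) t.
Proof.
move=> /cont_in_mxP hA; apply/cont_in_mxP => i j.
rewrite (_ : (fun s => _) = fun s => A s j i) //.
by apply/funext => s; rewrite mxE.
Qed.

Lemma cont_in_comp (T U : topologicalType) (f : T -> U) (p : R -> T) t :
  {for p t, continuous f} -> cont_in p t -> cont_in (f \o p) t.
Proof. by move=> fc pc; exact: (cvg_comp _ _ pc fc). Qed.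

Lemma cont_in_cst (T : topologicalType) (c : T) t : cont_in (cst c) t.
Proof. exact: cvg_cst. Qed.

Lemma cont_in_pair (V W : topologicalType) (f : R -> V) (g : R -> W) t :
  cont_in f t -> cont_in g t -> cont_in (fun s => (f s, g s)) t.
Proof. exact: cvg_pair. Qed.

(* A set of times that is relatively open sees the same limits as [0, tau]. *)
Lemma cont_in_within (T : topologicalType) (D : set R) (h : R -> T) :
  D `<=` `[0, tau] ->
  (forall t, D t -> \forall s \near t, s \in `[0, tau] -> D s) ->
  {within D, continuous h} <-> (forall t, D t -> cont_in h t).
Proof.
move=> DI Do; rewrite subspace_continuousP; split=> h' t Dt A /(h' t Dt).
  rewrite !nbhs_simpl /within /=; apply: filter_app; have := Do t Dt.
  by apply: filter_app; near=> s => /= Ds + ss => /(_ (Ds ss)).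
rewrite !nbhs_simpl /within /=; apply: filter_app.
by near=> s => + Ds => /(_ (DI _ Ds)).
Unshelve. all: by end_near. Qed.

End cont_in.

End matrix_valued.

(** * Absolute continuity *)

Section absolute_continuity.
Context {R : realType} (tau : R) {V : normedModType R}.
Implicit Types (h : R -> V) (a b t : R).

(** For vector values there is no intermediate point to use. The bound with slope [K + e'] holds
    around each tag by differentiability and adds up over adjacent intervals, so [cousin] globalises
    it. *)
Lemma mean_value h (d : R -> V) a b K : 0 <= a -> a <= b -> b <= tau ->
  (forall t, a <= t -> t <= b -> has_der tau h t (d t)) ->
  (forall t, a <= t -> t <= b -> `|d t| <= K) ->
  `|h b - h a| <= K * (b - a).
Proof.
move=> a0 ab bt hd dK; have ba0 : 0 < b - a + 1 by rewrite ltr_pwDr // subr_ge0.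
apply/ler_addgt0Pr => e e0; pose e' := e / (b - a + 1).
have e'0 : 0 < e' by rewrite divr_gt0.
suff : `|h b - h a| <= (K + e') * (b - a).
  move=> /le_trans; apply; rewrite mulrDl lerD2l /e' mulrAC ler_pdivrMr //.
  by rewrite ler_pM2l // lerDl.
apply: (@cousin _ a b (fun u v => `|h v - h u| <= (K + e') * (v - u))) => //.
  move=> u v w _ _ _ _ uv vw.
  rewrite -(subrKA (h v)) (le_trans (ler_normD _ _)) //.
  have -> : (K + e') * (w - u) = (K + e') * (w - v) + (K + e') * (v - u) by ring.
  exact: lerD.
move=> t at_ tb; have /nbhs_ballP[r /= r0 rP] := hd t at_ tb e' e'0.
have {}rP s : a <= s -> s <= b -> `|t - s| < r ->
    `|h s - h t| <= (K + e') * `|s - t|.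
  move=> as_ sb ts; have := rP s ts; rewrite in_itv /= (le_trans a0 as_).
  rewrite (le_trans sb bt) => /(_ isT) hs.
  rewrite -(subrK ((s - t) *: d t) (h s - h t)) (le_trans (ler_normD _ _)) //.
  by rewrite normrZ addrC mulrDl lerD // mulrC ler_wpM2r // dK.
exists r => // u v au ut tv vb tu vt.
rewrite -(subrKA (h t)) (le_trans (ler_normD _ _)) //.
have -> : (K + e') * (v - u) = (K + e') * (v - t) + (K + e') * (t - u) by ring.
rewrite lerD //.
  have := rP v (le_trans at_ tv) vb; rewrite distrC ger0_norm ?subr_ge0 //.
  exact.
have := rP u au (le_trans ut tb); rewrite ger0_norm ?subr_ge0 //.
by rewrite [`|u - t|]distrC ger0_norm ?subr_ge0 // distrC; exact.
Qed.

Lemma abs_cont_lipschitz h a b K :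
  (forall s t, a <= s -> s <= t -> t <= b -> `|h t - h s| <= K * (t - s)) ->
  abs_cont a b h.
Proof.
move=> hK e e0; have K0 : 0 < `|K| + 1 by rewrite ltr_wpDl.
exists (e / (`|K| + 1)); rewrite ?divr_gt0 // => s sall _.
rewrite ltr_pdivlMr // mulrC; apply: le_lt_trans.
rewrite mulr_sumr big_seq [leRHS]big_seq; apply: ler_sum => I Is.
have /allP/(_ I Is)/and3P[aI II Ib] := sall.
apply: le_trans (hK _ _ aI II Ib) _; rewrite ler_wpM2r ?subr_ge0 //.
by rewrite (le_trans (ler_norm K)) // lerDl.
Qed.

Lemma bounded_in (f : R -> V) a b : a <= b ->
  (forall t, a <= t -> t <= b -> exists2 r : R, 0 < r &
    forall s, a <= s -> s <= b -> `|t - s| < r -> `|f s - f t| <= 1) ->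
  exists2 K : R, 0 <= K & forall t, a <= t -> t <= b -> `|f t| <= K.
Proof.
move=> ab fc.
apply: (@cousin _ a b (fun u v => exists2 K, 0 <= K &
    forall t, u <= t -> t <= v -> `|f t| <= K)) => //.
  move=> u v w _ _ _ _ [K K0 hK] [L L0 hL]; exists (Num.max K L).
    by rewrite le_max K0.
  move=> t ut tw; rewrite le_max; have [tv|vt] := leP t v.
    by rewrite hK.
  by rewrite hL ?orbT // ltW.
move=> t at_ tb; have [r r0 rP] := fc t at_ tb.
exists r => // u v au ut tv vb tu vt; exists (`|f t| + 1); first exact: addr_ge0.
move=> s us sv; rewrite -(subrK (f t) (f s)) (le_trans (ler_normD _ _)) //.
rewrite addrC lerD2l; apply: rP; [exact: le_trans us|exact: le_trans sv _|].
by rewrite ltr_norml; apply/andP; split; lra.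
Qed.

Lemma abs_cont_bounded h a b : a <= b -> abs_cont a b h ->
  exists2 K : R, 0 <= K & forall t, a <= t -> t <= b -> `|h t| <= K.
Proof.
move=> ab /(_ 1 ltr01)[d d0 dP]; apply: bounded_in => // t at_ tb.
exists d => // s as_ sb; have [st|ts] := leP s t => tsd.
  have := dP [:: (s, t)]; rewrite /= !big_seq1 /= as_ st tb => /(_ isT isT).
  move=> H; rewrite distrC; apply/ltW/H.
  by rewrite (le_lt_trans (ler_norm _)).
have := dP [:: (t, s)]; rewrite /= !big_seq1 /= at_ (ltW ts) sb => /(_ isT isT).
move=> H; apply/ltW/H.
by rewrite (le_lt_trans (ler_norm _)) // distrC.
Qed.

Lemma cont_in_ball (T : normedModType R) (f : R -> T) a b t : 0 <= a -> b <= tau ->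
  cont_in tau f t -> exists2 r : R, 0 < r &
    forall s, a <= s -> s <= b -> `|t - s| < r -> `|f s - f t| <= 1.
Proof.
move=> a0 bt /cont_inP/(_ 1 ltr01)/nbhs_ballP[r /= r0 rP].
exists r => // s as_ sb ts; apply: rP => //.
by rewrite in_itv /= (le_trans a0) // (le_trans sb).
Qed.

Lemma abs_cont_C1 h (d : R -> V) a b : 0 <= a -> a <= b -> b <= tau ->
  (forall t, a <= t -> t <= b -> has_der tau h t (d t)) ->
  (forall t, a <= t -> t <= b -> cont_in tau d t) -> abs_cont a b h.
Proof.
move=> a0 ab bt hd dc.
have [t at_ tb|K K0 dK] := bounded_in (f := d) ab.
  exact/cont_in_ball/dc.
apply: (@abs_cont_lipschitz _ _ _ K) => s t as_ st tb.
apply: mean_value => //; first exact: le_trans a0 as_.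
- exact: le_trans tb bt.
- by move=> r sr rt; apply: hd; [exact: le_trans sr|exact: le_trans rt tb].
- by move=> r sr rt; apply: dK; [exact: le_trans sr|exact: le_trans rt tb].
Qed.

(* Cousin's lemma with the gauge given by differentiability off the null set and
   by an open cover of small measure on it. *)
Lemma abs_cont_const h a b : 0 <= a -> a <= b -> b <= tau -> abs_cont a b h ->
  {ae lebesgue_measure, forall t : R, t \in `[0, tau] -> has_der tau h t 0} ->
  h b = h a.
Proof.
move=> a0 ab bt hac [N [mN N0 badN]].
pose mu := @lebesgue_measure R; have {}N0 : mu N = 0%E := N0.
apply/eqP; rewrite -subr_eq0 -normr_eq0 eq_le normr_ge0 andbT.
apply/ler_addgt0Pr => e e0; rewrite add0r.
have ba0 : 0 < b - a + 1 by rewrite ltr_pwDr // subr_ge0.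
pose e' := e / (b - a + 1); have e'0 : 0 < e' by rewrite divr_gt0.
have [d d0 dP] := hac _ e'0.
have muD (A B : set R) : measurable A -> measurable B -> A `&` B = set0 ->
    mu (A `|` B) = (mu A + mu B)%E by exact: (@measureU _ _ _ (@lebesgue_measure R)).
have [|U [oU NU]] := @lebesgue_regularity_outer R N d mN _ d0.
  by rewrite (_ : _ N = 0%E) // ltry.
rewrite -/mu => muU.
have mU : measurable U by exact: measurable_realfun.open_measurable.
have {}muU : (mu U < d%:E)%E.
  apply: le_lt_trans muU; rewrite -[in X in (X <= _)%E](setDUK NU) muD //; last first.
    - by rewrite setDE setICA setICr setI0.
    - exact: measurableD.
  by rewrite N0 add0e.
pose len (s : seq (R * R)) := \sum_(I <- s) (I.2 - I.1).
pose var (s : seq (R * R)) := \sum_(I <- s) `|h I.2 - h I.1|.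
(* The invariant for [cousin]: the increment is at most [e'] times the length, up to the variation
   over finitely many intervals whose total length is paid for by [U]. Half-open intervals make that
   measure additive. *)
pose P u v := exists s : seq (R * R), [/\
  all (fun I => [&& u <= I.1, I.1 <= I.2 & I.2 <= v]) s,
  pairwise (fun I J => (I.2 <= J.1) || (J.2 <= I.1)) s,
  ((len s)%:E <= mu (U `&` `[u, v[))%E &
  `|h v - h u| <= e' * (v - u) + var s].
have mUI u v : measurable (U `&` `[u, v[).
  by apply: measurableI => //; exact: measurable_itv.
suff [s [sall spw slen sh]] : P a b.
  apply: le_trans sh _.
  have ls : len s < d.
    rewrite -lte_fin (le_lt_trans slen) // (le_lt_trans _ muU) //.
    apply: (@le_measure _ _ _ (@lebesgue_measure R));
      [by rewrite inE; exact: mUI|by rewrite inE|exact: subIsetl].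
  have vs : var s <= e' by apply/ltW/dP.
  apply: (@le_trans _ _ (e' * (b - a + 1))).
    by rewrite [leRHS]mulrDr mulr1 lerD2l.
  by rewrite /e' divfK // gt_eqF.
apply: cousin => //.
  move=> u v w au uv vw wb [s [sall spw slen sh]] [s' [sall' spw' slen' sh']].
  exists (s ++ s'); split.
  - rewrite all_cat; apply/andP; split.
      apply: sub_all sall => I /and3P[-> -> Iv] /=; exact: le_trans Iv vw.
    apply: sub_all sall' => I /and3P[vI -> ->]; rewrite !andbT.
    exact: le_trans uv vI.
  - rewrite pairwise_cat spw spw' !andbT; apply/allrelP => I J Is Js.
    have /allP/(_ I Is)/and3P[_ _ Iv] := sall.
    have /allP/(_ J Js)/and3P[vJ _ _] := sall'.
    by rewrite (le_trans Iv vJ).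
  - have -> : U `&` `[u, w[ = (U `&` `[u, v[) `|` (U `&` `[v, w[).
      rewrite -setIUr; congr (_ `&` _).
      rewrite -itv_bndbnd_setU //; exact: uv.
    rewrite muD //; last first.
      rewrite setIACA setIid -subset0 => r [_ [/=]].
      rewrite !in_itv /= => /andP[_ rv] /andP[vr _].
      by move: (lt_le_trans rv vr); rewrite ltxx.
    by rewrite /len big_cat /= EFinD leeD.
  - rewrite /var big_cat /= -/(var s) -/(var s').
    rewrite -(subrKA (h v)) (le_trans (ler_normD _ _)) //.
    have -> : e' * (w - u) + (var s + var s') =
      (e' * (w - v) + var s') + (e' * (v - u) + var s) by ring.
    exact: lerD.
(* A tag in [U] puts the whole interval into the list. A tag outside [U] puts nothing there: the
   derivative is zero at it, so the increment is already small. *)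
move=> t at_ tb; have [Ut|Ut] := pselect (U t).
  have /nbhs_ballP[r /= r0 rU] := open_nbhs_nbhs (conj oU Ut).
  exists r => // u v au ut tv vb tu vt; exists [:: (u, v)].
  have uv := le_trans ut tv; split => //=.
  - by rewrite lexx uv lexx.
  - rewrite /len big_seq1 /= setIidr; last first.
      move=> s /=; rewrite in_itv /= => /andP[us sv]; apply: rU.
      by rewrite /ball /= ltr_norml; apply/andP; split; lra.
    rewrite /mu lebesgue_measure_itv /= lte_fin; case: ltP => // vu.
    have -> : v = u by apply/le_anti; rewrite uv vu.
    by rewrite subrr.
  - by rewrite /var big_seq1 /= lerDr mulr_ge0 ?subr_ge0 ?(ltW e'0).
have tI : t \in `[0, tau] by rewrite in_itv /= (le_trans a0) // (le_trans tb).
have hd : has_der tau h t 0.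
  apply: contrapT => nhd; apply/Ut/NU/badN => /= /(_ tI); exact: nhd.
have /nbhs_ballP[r /= r0 rP] := hd e' e'0.
have {}rP s : a <= s -> s <= b -> `|t - s| < r -> `|h s - h t| <= e' * `|s - t|.
  move=> as_ sb ts; have := rP s ts; rewrite in_itv /= (le_trans a0 as_).
  by rewrite (le_trans sb bt) scaler0 subr0; exact.
exists r => // u v au ut tv vb tu vt; exists [::].
split; rewrite /len /var ?big_nil // ?measure_ge0 // addr0.
rewrite -(subrKA (h t)) (le_trans (ler_normD _ _)) //.
have -> : e' * (v - u) = e' * (v - t) + e' * (t - u) by ring.
rewrite lerD //.
  have := rP v (le_trans at_ tv) vb; rewrite distrC ger0_norm ?subr_ge0 //.
  exact.
have := rP u au (le_trans ut tb); rewrite ger0_norm ?subr_ge0 //.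
by rewrite [`|u - t|]distrC ger0_norm ?subr_ge0 // distrC; exact.
Qed.

(** Fields and configurations are absolutely continuous by definition only over time intervals spent
    in one chart; this is what remains of it for chart-free quantities on [[0, tau]]. *)
Definition locally_abs_cont h := forall t, t \in `[0, tau] ->
  exists2 r : R, 0 < r & forall a b, 0 <= a -> a <= t -> t <= b -> b <= tau ->
    t - a < r -> b - t < r -> abs_cont a b h.

Lemma locally_abs_cont_const h t : t \in `[0, tau] -> locally_abs_cont h ->
  {ae lebesgue_measure, forall s : R, s \in `[0, tau] -> has_der tau h s 0} ->
  h t = h 0.
Proof.
rewrite in_itv /= => /andP[t0 tt] hac h0.
apply: (@cousin _ 0 t (fun u v => h v = h u)) => // [u v w _ _ _ _ -> //|s s0 st].
have sI : s \in `[0, tau] by rewrite in_itv /= s0 (le_trans st).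
have [r r0 rP] := hac s sI; exists r => // u v u0 us sv vt su vs.
have vtau := le_trans vt tt.
by apply: abs_cont_const (rP _ _ _ _ _ _ su vs) h0 => //; exact: le_trans us sv.
Qed.

End absolute_continuity.

Section scalar_absolute_continuity.
Context {R : realType}.
Implicit Types (a b : R).

(** Absolute continuity is transported below by comparing increments: sums, products, entries and
    blocks of matrices are all instances. Dividing by [K + 1] covers the case [K = 0]. *)
Lemma abs_cont_le2 (U V W : normedModType R) (f : R -> U) (g : R -> V)
    (k : R -> W) a b K : 0 <= K ->
  (forall s t, a <= s -> s <= t -> t <= b ->
    `|k t - k s| <= K * (`|f t - f s| + `|g t - g s|)) ->
  abs_cont a b f -> abs_cont a b g -> abs_cont a b k.
Proof.
move=> K0 kK fac gac e e0; have K1 : 0 < K + 1 by rewrite ltr_wpDl.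
have e'0 : 0 < e / 2 / (K + 1) by rewrite !divr_gt0.
have [d d0 dP] := fac _ e'0; have [d' d'0 dP'] := gac _ e'0.
exists (Num.min d d'); first by rewrite lt_min d0.
move=> s sall spw; rewrite lt_min => /andP[sd sd'].
have := dP s sall spw sd; have := dP' s sall spw sd'.
rewrite !(ltr_pdivlMr _ _ K1) ![_ * (K + 1)]mulrC => gs fs.
have := ltrD fs gs; rewrite -splitr -mulrDr; apply: le_lt_trans.
rewrite -big_split mulr_sumr /= big_seq [leRHS]big_seq; apply: ler_sum => I Is.
have /allP/(_ I Is)/and3P[aI II Ib] := sall.
apply: le_trans (kK _ _ aI II Ib) _; rewrite ler_wpM2r ?addr_ge0 //.
by rewrite lerDl.
Qed.

Lemma abs_cont_le (U W : normedModType R) (f : R -> U) (k : R -> W) a b K :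
  0 <= K -> (forall s t, a <= s -> s <= t -> t <= b ->
    `|k t - k s| <= K * `|f t - f s|) ->
  abs_cont a b f -> abs_cont a b k.
Proof.
move=> K0 kK fac; apply: (abs_cont_le2 K0 _ fac fac) => s t as_ st tb.
by rewrite (le_trans (kK _ _ as_ st tb)) // ler_wpM2l // lerDl.
Qed.

Lemma abs_cont_cst (V : normedModType R) (c : V) a b : abs_cont a b (cst c).
Proof.
by apply: (@abs_cont_lipschitz _ _ _ _ _ 0) => s t _ _ _; rewrite subrr normr0 mul0r.
Qed.

Lemma abs_contD (V : normedModType R) (f g : R -> V) a b :
  abs_cont a b f -> abs_cont a b g -> abs_cont a b (fun s => f s + g s).
Proof.
apply: (@abs_cont_le2 _ _ _ _ _ _ _ _ 1) => // s t _ _ _.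
by rewrite mul1r opprD addrACA ler_normD.
Qed.

Lemma abs_cont_sum (V : normedModType R) (I : Type) (r : seq I)
    (f : I -> R -> V) a b : (forall i, abs_cont a b (f i)) ->
  abs_cont a b (fun s => \sum_(i <- r) f i s).
Proof.
move=> fac; elim: r => [|i r IH].
  rewrite (_ : (fun s => _) = cst 0); first exact: abs_cont_cst.
  by apply/funext => s; rewrite big_nil.
rewrite (_ : (fun s => _) = fun s => f i s + \sum_(j <- r) f j s).
  exact: abs_contD.
by apply/funext => s; rewrite big_cons.
Qed.

Lemma abs_contM (f g : R -> R) a b : a <= b ->
  abs_cont a b f -> abs_cont a b g -> abs_cont a b (fun s => f s * g s).
Proof.
move=> ab fac gac; have [K K0 fK] := abs_cont_bounded ab fac.
have [L L0 gL] := abs_cont_bounded ab gac.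
apply: (@abs_cont_le2 _ _ _ _ _ _ _ _ (K + L)) fac gac; first exact: addr_ge0.
move=> s t as_ st tb.
have -> : f t * g t - f s * g s = g t * (f t - f s) + f s * (g t - g s) by ring.
rewrite (le_trans (ler_normD _ _)) // !normrM mulrDr lerD // ler_wpM2r //.
  by rewrite (le_trans (gL _ _ _)) // ?lerDr //; exact: le_trans as_ st.
by rewrite (le_trans (fK _ _ _)) // ?lerDl //; exact: le_trans st tb.
Qed.

Lemma abs_cont_coord m n (A : R -> 'M[R]_(m, n)) a b i j :
  abs_cont a b A -> abs_cont a b (fun s => A s i j).
Proof.
apply: (@abs_cont_le _ _ _ _ _ _ 1) => // s t _ _ _; rewrite mul1r.
have := lexx `|A t - A s|; rewrite [X in X -> _]mx_norm_leP // => /(_ i j).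
by rewrite !mxE.
Qed.

Lemma abs_cont_mulmx_coord m n p (A : R -> 'M[R]_(m, n)) (B : R -> 'M[R]_(n, p))
    a b i j : a <= b ->
  abs_cont a b A -> abs_cont a b B -> abs_cont a b (fun s => (A s *m B s) i j).
Proof.
move=> ab hA hB; rewrite (_ : (fun s => _) = fun s => \sum_k A s i k * B s k j);
  last by apply/funext => s; rewrite mxE.
by apply: abs_cont_sum => k; apply: abs_contM => //; exact: abs_cont_coord.
Qed.

End scalar_absolute_continuity.

(** * The fundamental theorem of calculus, end points included *)

Section primitive.
Context {R : realType} (tau : R).

Lemma has_der_primitive (f : R -> R) t : t \in `[0, tau] ->
  (forall s, s \in `[0, tau] -> cont_in tau f s) ->
  has_der tau (fun s => \int[lebesgue_measure]_(r in `[0, s]) f r) t (f t).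
Proof.
move=> tI fc; have := tI; rewrite in_itv /= => /andP[t0 tt].
(* Composing with the retraction onto [[0, tau]] extends [f] continuously to the line, so that the
   two-sided theorem also applies at the end points. *)
pose clamp (s : R) := Num.max 0 (Num.min s tau).
have clampI s : clamp s \in `[0, tau].
  by rewrite in_itv /= le_max lexx ge_max (le_trans t0 tt) ge_min lexx orbT.
have clampE s : s \in `[0, tau] -> clamp s = s.
  by rewrite in_itv /= => /andP[s0 st]; rewrite /clamp (min_idPl st) (max_idPr s0).
have clampc : continuous clamp.
  move=> s; have : {for s, continuous
      ((cst 0 : R -> R^o) \max ((id : R -> R^o) \min cst tau))}.
    apply: continuous_max; first exact: cst_continuous.
    by apply: continuous_min; [exact: cvg_id|exact: cst_continuous].
  exact.
pose g := f \o clamp.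
have gc : continuous g.
  move=> s; have cs : clamp @ s --> within `[0, tau] (nbhs (clamp s)).
    move=> A Aw; have := clampc s _ (Aw : nbhs (clamp s) (fun r => r \in `[0, tau] -> A r)).
    rewrite !nbhs_simpl => As; apply: (filterS (F := nbhs s) _ As) => r /=.
    by apply; exact: clampI.
  exact: cvg_comp cs (fc _ (clampI s)).
have gint (u : R) : lebesgue_measure.-integrable `[-1, u] (EFin \o g).
  apply: continuous_compact_integrable; first exact: segment_compact.
  exact: continuous_subspaceT.
(* Integrating from -1 makes [t = 0] an interior point; the constant [G 0] is subtracted
   afterwards. *)
pose G x := \int[lebesgue_measure]_(r in `[-1, x]) g r.
have [||||dG G't] := @continuous_FTC1_closed R g (-1) t (t + 1).
- by rewrite ltrDl.
- exact: gint.
- by rewrite (lt_le_trans _ t0).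
- exact: gc.
have tG : has_der tau (fun s => G s - G 0) t (f t).
  have dG' : differentiable G t by apply/derivable1_diffP.
  have idd : has_der tau (id : R -> R) t 1.
    have := has_der_affine tau (0 : R) (1 : R) t.
    apply: has_der_eq_in => // s _; rewrite add0r; exact: mulr1.
  have := has_der_comp (tau := tau) (f := G) (p := id) dG' idd.
  rewrite (_ : 'd G (id t) 1 = f t); last first.
    by rewrite -deriveE // -derive1E G't /g /= clampE.
  move=> /has_derD /(_ (has_der_cst tau (- G 0) t)); rewrite addr0; exact.
apply: has_der_eq_in tG => // s sI; have := sI.
rewrite in_itv /= => /andP[s0 st].
rewrite /G (Rintegral_itvB (gint s)) ?bnd_simp ?lerN10 //.
rewrite Rintegral_itv_obnd_cbnd; last first.
  apply: integrableS (gint s) => //.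
  by apply: subset_itvr; rewrite bnd_simp lerN10.
apply: eq_Rintegral => r; rewrite inE /= in_itv /= => /andP[r0 rs].
by rewrite /g /= clampE // in_itv /= r0 (le_trans rs st).
Qed.

End primitive.

(** * Symmetry of second derivatives *)

Lemma subr_interchange (V : zmodType) (x y z w : V) :
  (x - y) - (z - w) = (x - z) - (y - w).
Proof. by rewrite [in LHS]opprD [LHS]addrACA -opprD. Qed.

Section symmetry_of_second_derivatives.
Context {R : realType} {U W : normedModType R}.
Implicit Types (f : U -> W) (p u v : U).

Lemma has_der_along tau f p u t : differentiable f (p + t *: u) ->
  has_der tau (fun s => f (p + s *: u)) t ('D_u f (p + t *: u)).
Proof.
move=> df; rewrite deriveE //.
exact: (@has_der_comp _ tau _ _ f (fun s => p + s *: u) t u df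
  (has_der_affine tau p u t)).
Qed.

(** For fixed [h], let the base point move along [s u]: the increment of [f] across [h v] has
    derivative [D_u f (p + h v + s u) - D_u f (p + s u)], which is within [e h] of [h D_v D_u f p].
    The mean value inequality for [s] in [[0, h]] supplies the second factor [h]. *)
Lemma second_difference f p u v e :
  (\forall q \near p, differentiable f q) -> differentiable ('D_u f) p -> 0 < e ->
  exists2 r : R, 0 < r & forall h, 0 < h -> h < r ->
    `|f (p + h *: u + h *: v) - f (p + h *: u) - (f (p + h *: v) - f p) -
      (h * h) *: 'D_v ('D_u f) p| <= e * (h * h).
Proof.
move=> df dg e0; set g := 'D_u f in dg *; pose X := 'D_v g p.
(* [h c] dominates the sum of the distances from [p] to [p + s u] and to [p + h v + s u]; the 1
   makes [c] positive. *)
pose c := `|u| + `|v| + `|u| + 1.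
have c0 : 0 < c by rewrite /c ltr_wpDl // !addr_ge0.
have e'0 : 0 < e / c by rewrite divr_gt0.
have go : \forall q \near p, `|g q - g p - 'd g p (q - p)| <= e / c * `|q - p|.
  have := diff_locally dg; move=> /eqaddoP /(_ _ e'0) go.
  have {go} : \forall q \near (0 : U), `|(g \o shift p -
    (cst (g p) + 'd g p)) q| <= e / c * `|q| by exact: go.
  rewrite (near_shift p 0); apply: filter_app; near=> q.
  by rewrite /= !fctE sub0r subrK opprD addrA.
have /nbhs_ballP[r /= r0 rP] : \forall q \near p, differentiable f q /\
    `|g q - g p - 'd g p (q - p)| <= e / c * `|q - p|.
  by near=> q; split; near: q.
exists (r / c); first by rewrite divr_gt0.
move=> h h0 hr; have hcr : h * c < r by rewrite -ltr_pdivlMr.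
have su s : 0 <= s -> s <= h -> `|s *: u| <= h * `|u|.
  by move=> s0 sh; rewrite normrZ ger0_norm // ler_wpM2r.
have hv : `|h *: v| = h * `|v| by rewrite normrZ gtr0_norm.
have near1 s : 0 <= s -> s <= h -> ball p r (p + s *: u).
  move=> s0 sh; rewrite -ball_normE /= opprD addNKr normrN.
  apply: le_lt_trans hcr; rewrite (le_trans (su _ s0 sh)) // ler_wpM2l ?(ltW h0) //.
  by rewrite /c -!addrA lerDl !addr_ge0.
have near2 s : 0 <= s -> s <= h -> ball p r (p + h *: v + s *: u).
  move=> s0 sh; rewrite -ball_normE /= -addrA opprD addNKr normrN.
  rewrite (le_lt_trans (ler_normD _ _)) //; apply: le_lt_trans hcr.
  rewrite hv (le_trans (lerD (lexx _) (su _ s0 sh))) // -mulrDr.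
  rewrite ler_wpM2l ?(ltW h0) // /c.
  by rewrite [`|u| + `|v|]addrC -!addrA !lerD // ?lerDl ?addr_ge0.
pose k s := f (p + h *: v + s *: u) + (- f (p + s *: u) + (0 + s *: (- (h *: X)))).
have kd s : 0 <= s -> s <= h -> has_der h k s
    (g (p + h *: v + s *: u) + (- g (p + s *: u) + - (h *: X))).
  move=> s0 sh; have [d1 _] := rP _ (near1 s s0 sh).
  have [d2 _] := rP _ (near2 s s0 sh).
  apply: has_derD; first exact: has_der_along.
  apply: has_derD; last exact: has_der_affine.
  have := @has_der_along h (- f) p u s (differentiableN d1).
  by rewrite deriveN //; exact: diff_derivable.
have kb s : 0 <= s -> s <= h ->
    `|g (p + h *: v + s *: u) + (- g (p + s *: u) + - (h *: X))| <= e * h.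
  move=> s0 sh; have [_ b1] := rP _ (near1 s s0 sh).
  have [_ b2] := rP _ (near2 s s0 sh).
  have -> : g (p + h *: v + s *: u) + (- g (p + s *: u) + - (h *: X)) =
    (g (p + h *: v + s *: u) - g p - 'd g p (p + h *: v + s *: u - p)) -
    (g (p + s *: u) - g p - 'd g p (p + s *: u - p)).
    rewrite -[p + h *: v + _]addrA ![p + _ - p]addrAC !subrr !add0r linearD /=.
    rewrite [X in - (h *: X)](_ : _ = 'd g p v); last by rewrite /X deriveE.
    by rewrite -linearZ subr_interchange addrK opprB subrKA [LHS]addrA.
  apply: le_trans (ler_normB _ _) _; apply: le_trans (lerD b2 b1) _.
  have n1 : `|p + s *: u - p| <= h * `|u| by rewrite addrAC subrr add0r su.
  have n2 : `|p + h *: v + s *: u - p| <= h * `|v| + h * `|u|.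
    rewrite addrAC [p + _ - p]addrAC subrr add0r (le_trans (ler_normD _ _)) // hv lerD2l.
    exact: su.
  rewrite -mulrDr; apply: (@le_trans _ _ (e / c * (h * c))).
    rewrite ler_pM2l // (le_trans (lerD n2 n1)) // -!mulrDr ler_pM2l //.
    by rewrite /c [`|u| + `|v|]addrC lerDl.
  by rewrite [h * c]mulrC mulrA divfK ?gt_eqF.
have := @mean_value R h W k _ 0 h (e * h) (lexx _) (ltW h0) (lexx _) kd kb.
rewrite subr0 -mulrA; apply: le_trans; rewrite le_eqVlt; apply/orP; left.
apply/eqP; congr `| _ |; rewrite /k !scale0r !addr0 add0r scalerN scalerA.
rewrite [p + h *: v + h *: u]addrAC addrA -/X.
by rewrite [LHS]addrAC.
Unshelve. all: by end_near. Qed.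

(** The second difference is symmetric in [u] and [v], and [h^2] times either mixed derivative
    approximates it. *)
Lemma derive_comm f p u v : (\forall q \near p, differentiable f q) ->
  differentiable ('D_u f) p -> differentiable ('D_v f) p ->
  'D_v ('D_u f) p = 'D_u ('D_v f) p.
Proof.
move=> df du dv; apply/eqP; rewrite -subr_eq0 -normr_le0.
apply/ler_addgt0Pr => e e0; rewrite add0r; have e2 : 0 < e / 2 by rewrite divr_gt0.
have [r r0 rP] := second_difference v df du e2.
have [r' r'0 rP'] := second_difference u df dv e2.
pose h := Num.min r r' / 2.
have m0 : 0 < Num.min r r' by rewrite lt_min r0.
have h0 : 0 < h by rewrite divr_gt0.
have hm : h < Num.min r r' by rewrite ltr_pdivrMr // ltr_pMr // ltr1n.
have [hr hr'] : h < r /\ h < r' by move: hm; rewrite lt_min => /andP[].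
have := rP h h0 hr; have := rP' h h0 hr'.
rewrite [p + h *: v + h *: u]addrAC [f _ - f (p + h *: v) - _]subr_interchange.
move=> b2 b1; have hh : 0 < h * h by rewrite mulr_gt0.
rewrite -(ler_pM2l hh) -{1}(gtr0_norm hh) -normrZ scalerBr [h * h * e]mulrC.
rewrite [e]splitr mulrDl; set S := _ - (f _ - f p) in b1 b2.
apply: le_trans (ler_distD S _ _) _; rewrite lerD //.
by rewrite distrC; exact: b1.
Qed.

End symmetry_of_second_derivatives.

(** * The connection in charts *)

Lemma cont_in_nbhs (R : realType) (tau : R) (T : topologicalType) (h : R -> T) t
    (A : set T) : cont_in tau h t -> nbhs (h t) A ->
  \forall s \near t, s \in `[0, tau] -> A (h s).
Proof. by move=> hc /hc. Qed.

Section charts.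
Context {R : realType} {n : nat} (M : riemannian R n).
Implicit Types (i j k : chart_index M) (y : M) (p u v w : 'rV[R]_n).

Lemma derive_sum_delta (V : normedModType R) (f : 'rV[R]_n -> V) p v :
  differentiable f p ->
  'D_v f p = \sum_a v 0 a *: 'D_(delta_mx 0 a) f p.
Proof.
move=> df; rewrite deriveE // {1}[v]row_sum_delta linear_sum /=.
by apply: eq_bigr => a _; rewrite linearZ /= deriveE.
Qed.

Lemma dom_near i y : dom i y -> \forall q \near chart i y, (chart i @` dom i) q.
Proof.
by move=> iy; apply: open_nbhs_nbhs; split; [exact: chart_open|exists y].
Qed.

Lemma dom2_near i j y : dom i y -> dom j y ->
  \forall q \near chart i y, (chart i @` (dom i `&` dom j)) q.
Proof.
move=> iy jy; have iq := dom_near iy.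
have uc : {for chart i y, continuous (unchart i)}.
  by apply: unchart_continuous; exists y.
have : nbhs (unchart i (chart i y)) (dom j).
  by rewrite chartK //; apply: open_nbhs_nbhs; split => //; exact: dom_open.
move=> jn; have jq : nbhs (chart i y) (unchart i @^-1` dom j) := uc _ jn.
near=> q; have [z iz zq] : (chart i @` dom i) q by near: q.
have : dom j (unchart i q) by near: q; exact: jq.
by rewrite -zq chartK // => jz; exists z.
Unshelve. all: by end_near. Qed.

Lemma transition_differentiable i j y : dom i y -> dom j y ->
  differentiable (chart j \o unchart i) (chart i y).
Proof.
by move=> iy jy; have [h _] := transition_smooth i j 1%N; apply: h; exists y.
Qed.

Lemma transition_derive_differentiable i j y v : dom i y -> dom j y ->
  differentiable ('D_v (chart j \o unchart i)) (chart i y).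
Proof.
move=> iy jy; have [_ /(_ v)[h _]] := transition_smooth i j 2%N; apply: h.
by exists y.
Qed.

Lemma metric_differentiable i y : dom i y ->
  differentiable (metric i) (chart i y).
Proof. by move=> iy; have [h _] := metric_smooth i 1%N; apply: h; exists y. Qed.

Lemma metric_derive_continuous i y v : dom i y ->
  {for chart i y, continuous ('D_v (metric i))}.
Proof. by move=> iy; have [_ /(_ v) h] := metric_smooth i 1%N; apply: h; exists y. Qed.

Lemma mulmx_transition i j y v : dom i y -> dom j y ->
  v *m transition i j y = 'D_v (chart j \o unchart i) (chart i y).
Proof. by move=> iy jy; rewrite deriveEjacobian //; exact: transition_differentiable. Qed.

Lemma transition_refl i y : dom i y -> transition i i y = 1%:M.
Proof.
move=> iy; apply/row_matrixP => a; rewrite !rowE mulmx1 mulmx_transition //.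
rewrite -[RHS](derive_id (chart i y)).
apply: near_eq_derive; near=> q.
have [z iz <-] : (chart i @` dom i) q by near: q; exact: dom_near.
by rewrite /= chartK.
Unshelve. all: by end_near. Qed.

(** The derivative along [u] of the Jacobian of the coordinate change: [w *m hessian i j y u] is its
    second derivative in the directions [u] and [w]. It is the inhomogeneous term in the
    transformation of accelerations and of the connection. *)
Definition hessian i j y u : 'M[R]_n := \matrix_(a, b)
  'D_u ('D_(delta_mx 0 a) (chart j \o unchart i)) (chart i y) 0 b.

Lemma hessian_sym i j y u v : dom i y -> dom j y ->
  u *m hessian i j y v = v *m hessian i j y u.
Proof.
move=> iy jy; set F := chart j \o unchart i; set p := chart i y.
have dF a : differentiable ('D_(delta_mx 0 a) F) p.
  exact: transition_derive_differentiable.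
have E w z : w *m hessian i j y z = \sum_a \sum_b (w 0 a * z 0 b) *:
    'D_(delta_mx 0 b) ('D_(delta_mx 0 a) F) p.
  apply/rowP => c; rewrite mxE summxE; apply: eq_bigr => a _.
  rewrite mxE derive_sum_delta // !summxE mulr_sumr; apply: eq_bigr => b _.
  by rewrite !mxE mulrA.
rewrite !E exchange_big; apply: eq_bigr => b _; apply: eq_bigr => a _.
apply: (congr2 (fun (x : R) (z : 'rV[R]_n) => x *: z) (mulrC _ _)).
apply: derive_comm => //.
near=> q; have [z [iz jz] <-] : (chart i @` (dom i `&` dom j)) q.
  by near: q; exact: dom2_near.
exact: transition_differentiable.
Unshelve. all: by end_near. Qed.

Lemma has_der_transition tau i j (c : R -> 'rV[R]_n) t u y :
  t \in `[0, tau] -> dom i y -> dom j y -> c t = chart i y ->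
  has_der tau c t u ->
  has_der tau (fun s => jacobian (chart j \o unchart i) (c s)) t (hessian i j y u).
Proof.
move=> tI iy jy cy cu; set F := chart j \o unchart i.
(* [jacobian] comes from the differential. It agrees with the matrix of partial derivatives, which
   is differentiated entry by entry, where the coordinate change is differentiable; this holds near
   [chart i y]. *)
pose J q : 'M[R]_n := \matrix_(a, b) 'D_(delta_mx 0 a) F q 0 b.
have JE : \forall s \near t, s \in `[0, tau] -> J (c s) = jacobian F (c s).
  have cc := has_der_continuous cu.
  have ct : nbhs (c t) (chart i @` (dom i `&` dom j)).
    by rewrite cy; exact: dom2_near.
  apply: filterS (cont_in_nbhs cc ct) => s h ss.
  have [z [iz jz] zc] := h ss; apply/matrixP => a b.
  rewrite mxE -zc -mulmx_transition // -rowE mxE //.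
apply: has_der_near_eq JE _ => //; apply/has_der_mxP => a b.
rewrite (_ : (fun s => _) = fun s => 'D_(delta_mx 0 a) F (c s) 0 b); last first.
  by apply/funext => s; rewrite mxE.
have dF : differentiable ('D_(delta_mx 0 a) F) (c t).
  by rewrite cy; exact: transition_derive_differentiable.
have := has_der_comp dF cu; rewrite cy -deriveE; last by rewrite -cy.
by move=> /has_der_mxP /(_ 0 b); rewrite !mxE.
Qed.

Lemma has_der_metric tau i (c : R -> 'rV[R]_n) t u y :
  dom i y -> c t = chart i y -> has_der tau c t u ->
  has_der tau (fun s => metric i (c s)) t ('D_u (metric i) (chart i y)).
Proof.
move=> iy cy cu; have dG : differentiable (metric i) (c t).
  by rewrite cy; exact: metric_differentiable.
by have := has_der_comp dG cu; rewrite cy -deriveE // -cy.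
Qed.

(** The product rule for [g_i = J g_j J^T] along the straight line of direction [u]; uniqueness of
    the one-sided derivative at 0 identifies both sides. *)
Lemma metric_derive_change i j y u : dom i y -> dom j y ->
  let J := transition i j y in let H := hessian i j y u in
  let G := metric j (chart j y) in
  'D_u (metric i) (chart i y) = H *m G *m J^T +
    J *m 'D_(u *m J) (metric j) (chart j y) *m J^T + J *m G *m H^T.
Proof.
move=> iy jy J H G; set F := chart j \o unchart i.
have t0 : (0 : R) \in `[0, 1] by rewrite in_itv /= lexx ler01.
pose c (s : R) : 'rV[R]_n := chart i y + s *: u.
have c0 : c 0 = chart i y by rewrite /c scale0r addr0.
have cu : has_der 1 c 0 u by exact: has_der_affine.
have dF : differentiable F (c 0) by rewrite c0; exact: transition_differentiable.
have Fu : has_der 1 (F \o c) 0 (u *m J).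
  rewrite mulmx_transition // -c0 deriveE //; exact: has_der_comp dF cu.
have Fc0 : (F \o c) 0 = chart j y by rewrite /= c0 /F /= chartK.
have hJ := has_der_transition t0 iy jy c0 cu.
have hG := has_der_metric jy Fc0 Fu.
have h1 := has_der_metric iy c0 cu.
have h2 := has_der_mulmx (has_der_mulmx hJ hG) (has_der_trmx hJ).
have e : \forall s \near (0 : R), s \in `[0, 1] ->
    jacobian F (c s) *m metric j ((F \o c) s) *m (jacobian F (c s))^T =
    metric i (c s).
  have cc := has_der_continuous cu.
  have ct : nbhs (c 0) (chart i @` (dom i `&` dom j)).
    by rewrite c0; exact: dom2_near.
  apply: filterS (cont_in_nbhs cc ct) => s h ss.
  have [z [iz jz] zc] := h ss.
  by rewrite [(F \o c) s]/(F (c s)) -zc (metric_transition iz jz) /F /= chartK.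
have {}h2 := has_der_near_eq t0 e h2.
rewrite (has_der_unique ltr01 t0 h1 h2) mulmxDl.
by rewrite -/F Fc0 c0.
Qed.

Definition dmetric_mx i p v : 'M[R]_n :=
  \matrix_(b, m) \sum_a v 0 a * dmetric i a b m p.

(* [koszul_mx i p v] sends [w] to [w *m koszul_mx i p v], the first-kind
   Christoffel symbols contracted with [v] and [w]. *)
Definition koszul_mx i p v : 'M[R]_n :=
  let A := \matrix_(b, m) \sum_a v 0 a * dmetric i b a m p in
  2^-1 *: (dmetric_mx i p v + A - A^T).

Definition connection_mx i p v : 'M[R]_n :=
  \matrix_(b, k) \sum_a christoffel i p k a b * v 0 a.

Lemma christoffel_formE i p v w :
  christoffel_form i p v w = w *m connection_mx i p v.
Proof.
apply/rowP => k; rewrite !mxE exchange_big; apply: eq_bigr => b _.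
by rewrite !mxE mulr_sumr; apply: eq_bigr => a _; rewrite mulrC.
Qed.

Lemma metric_unit i y : dom i y -> metric i (chart i y) \in unitmx.
Proof.
move=> iy; rewrite -row_free_unit -kermx_eq0; apply/negP => /negP /rowV0Pn.
move=> [v vk v0]; have /metric_pos /(_ v v0) : (chart i @` dom i) (chart i y).
  by exists y.
by move/sub_kermxP: vk => ->; rewrite mul0mx mxE ltxx.
Qed.

Lemma metric_symm i y : dom i y ->
  (metric i (chart i y))^T = metric i (chart i y).
Proof. by move=> iy; apply: Defs.metric_sym; exists y. Qed.

Lemma dmetricE i a b c y : dom i y ->
  dmetric i a b c (chart i y) = 'D_(delta_mx 0 a) (metric i) (chart i y) b c.
Proof.
move=> iy; rewrite derive_mx ?mxE //.
exact/diff_derivable/metric_differentiable.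
Qed.

Lemma dmetric_mxE i y v : dom i y ->
  dmetric_mx i (chart i y) v = 'D_v (metric i) (chart i y).
Proof.
move=> iy; rewrite derive_sum_delta; last exact: metric_differentiable.
apply/matrixP => b m; rewrite mxE summxE; apply: eq_bigr => a _.
by rewrite !mxE dmetricE.
Qed.

(** Lowering the index cancels the inverse metric in the Christoffel symbols. The connection enters
    the continuity arguments through this product. *)
Lemma connection_mx_metric i y v : dom i y ->
  connection_mx i (chart i y) v *m metric i (chart i y) =
  koszul_mx i (chart i y) v.
Proof.
move=> iy; set p := chart i y; set G := metric i p.
rewrite /koszul_mx; set C := (X in _ *: X).
have -> : connection_mx i p v = 2^-1 *: (C *m (invmx G)^T).
  apply/matrixP => b k; rewrite [LHS]mxE [RHS]mxE [X in _ = _ * X]mxE mulr_sumr.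
  transitivity (\sum_a \sum_l 2^-1 * (invmx G k l *
      (dmetric i a b l p + dmetric i b a l p - dmetric i l a b p) * v 0 a)).
    by apply: eq_bigr => a _; rewrite /christoffel -mulrA mulr_suml mulr_sumr.
  rewrite exchange_big; apply: eq_bigr => l _.
  rewrite -mulr_sumr [(invmx G)^T l k]mxE; congr (_ * _).
  rewrite /C !mxE -sumrN -!big_split mulr_suml; apply: eq_bigr => a _ /=.
  set d1 := dmetric _ _ _ _ _; set d2 := dmetric _ _ _ _ _.
  set d3 := dmetric _ _ _ _ _; ring.
rewrite -scalemxAl -mulmxA trmx_inv metric_symm // mulVmx ?mulmx1 //.
exact: metric_unit.
Qed.

Lemma dmetric_symm i y v : dom i y ->
  (dmetric_mx i (chart i y) v)^T = dmetric_mx i (chart i y) v.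
Proof.
move=> iy; apply/matrixP => b c; rewrite !mxE; apply: eq_bigr => a _.
rewrite !dmetricE //; congr (_ * _).
have t0 : (0 : R) \in `[0, 1] by rewrite in_itv /= lexx ler01.
pose l (s : R) : 'rV[R]_n := chart i y + s *: delta_mx 0 a.
have l0 : l 0 = chart i y by rewrite /l scale0r addr0.
have lu : has_der 1 l 0 (delta_mx 0 a) by exact: has_der_affine.
have h := has_der_metric iy l0 lu.
have e : \forall s \near (0 : R), s \in `[0, 1] ->
    (metric i (l s))^T = metric i (l s).
  have lc := has_der_continuous lu.
  have lt : nbhs (l 0) (chart i @` dom i) by rewrite l0; exact: dom_near.
  apply: filterS (cont_in_nbhs lc lt) => s h' ss.
  exact: Defs.metric_sym (h' ss).
have h2 := has_der_near_eq t0 e (has_der_trmx h).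
by rewrite {1}(has_der_unique ltr01 t0 h h2) mxE.
Qed.

(** The Levi-Civita connection is metric: the part [A - A^T] of the Koszul matrix drops out of the
    symmetrisation, and the two halves of the derivative of [g] add up. *)
Lemma connection_compat i y v : dom i y ->
  let G := metric i (chart i y) in let C := connection_mx i (chart i y) v in
  C *m G + G *m C^T = 'D_v (metric i) (chart i y).
Proof.
move=> iy G C; have -> : G *m C^T = (C *m G)^T by rewrite trmx_mul /G metric_symm.
rewrite connection_mx_metric // /koszul_mx -dmetric_mxE //.
set D := dmetric_mx _ _ _; set A := \matrix_(_, _) _.
have DT : D^T = D by exact: dmetric_symm.
apply/matrixP => a b; have /matrixP/(_ a b) := DT.
by rewrite !mxE => e; rewrite e; field.
Qed.

(** With both arguments equal to [v], the lowered symbols involve the derivatives of [g] along [v]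
    and along the test vector [w] alone. In this form the change of chart becomes a matrix
    identity. *)
Lemma koszul_quadratic i y v w : dom i y ->
  v *m koszul_mx i (chart i y) v *m w^T =
  v *m 'D_v (metric i) (chart i y) *m w^T -
  2^-1 *: (v *m 'D_w (metric i) (chart i y) *m v^T).
Proof.
move=> iy; rewrite -!dmetric_mxE // /koszul_mx; set A := \matrix_(_, _) _.
have vA : v *m A = v *m dmetric_mx i (chart i y) v.
  apply/rowP => m; rewrite !mxE.
  under eq_bigr do rewrite mxE mulr_sumr.
  rewrite exchange_big; apply: eq_bigr => a _; rewrite mxE mulr_sumr.
  by apply: eq_bigr => b _; rewrite mulrCA.
have wA : w *m A = v *m dmetric_mx i (chart i y) w.
  apply/rowP => m; rewrite !mxE.
  under eq_bigr do rewrite mxE mulr_sumr.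
  rewrite exchange_big; apply: eq_bigr => a _; rewrite mxE mulr_sumr.
  by apply: eq_bigr => b _; rewrite mulrCA.
have vAT : v *m A^T *m w^T = v *m dmetric_mx i (chart i y) w *m v^T.
  have tr1 (X : 'M[R]_1) : X^T = X.
    by apply/matrixP => a b; rewrite mxE !ord1.
  by rewrite -[LHS]tr1 !trmx_mul !trmxK mulmxA wA.
rewrite -scalemxAr -scalemxAl mulmxBr mulmxDr mulmxBl mulmxDl vA vAT.
move: (v *m _ *m w^T) (v *m _ *m v^T) => X Y.
by apply/matrixP => a b; rewrite !mxE; field.
Qed.

End charts.

(** * Orthonormal frames in the plane *)

Section plane_linear_algebra.
Context {R : realType}.
Implicit Types (G B : 'M[R]_2) (v w : 'rV[R]_2).

(** Acting on rows from the right, this is the positive right-angle rotation, sending [(a, b)] to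
    [(- b, a)]. *)
Definition quarter_turn : 'M[R]_2 :=
  \matrix_(i, j) (if i == j then 0 else if i == 0 then 1 else -1).

Lemma sum2 (V : nmodType) (F : 'I_2 -> V) : \sum_i F i = F 0 + F 1.
Proof.
rewrite !big_ord_recl big_ord0 addr0; congr (_ + F _); exact: val_inj.
Qed.

Lemma ord2P (i : 'I_2) : i = 0 \/ i = 1.
Proof. by case: i => [[|[|]]] // h; [left|right]; apply: val_inj. Qed.

Lemma matrix2P (A B : 'M[R]_2) : A 0 0 = B 0 0 -> A 0 1 = B 0 1 ->
  A 1 0 = B 1 0 -> A 1 1 = B 1 1 -> A = B.
Proof.
move=> e1 e2 e3 e4; apply/matrixP => i j.
by case: (ord2P i) => ->; case: (ord2P j) => ->.
Qed.

Lemma det2E (A : 'M[R]_2) : \det A = A 0 0 * A 1 1 - A 0 1 * A 1 0.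
Proof.
rewrite (expand_det_row _ 0) sum2 /cofactor !det_mx11 !mxE /=.
rewrite (_ : lift 0 0 = 1 :> 'I_2); last exact: val_inj.
rewrite (_ : lift 1 0 = 0 :> 'I_2); last exact: val_inj.
by rewrite addn0 add0n expr0 expr1; ring.
Qed.

Lemma trmx11 (X : 'M[R]_1) : X^T = X.
Proof. by apply/matrixP => a b; rewrite mxE !ord1. Qed.

(** Conjugation by the quarter turn sends a symmetric 2 by 2 matrix to its adjugate. *)
Lemma quarter_turn_metric G : G^T = G ->
  quarter_turn *m G *m quarter_turn^T *m G = (\det G)%:M.
Proof.
move=> /matrixP/(_ 0 1); rewrite mxE => s; apply: matrix2P;
  by rewrite !mxE !sum2 !mxE !sum2 !mxE !sum2 !mxE /= det2E s; ring.
Qed.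

Lemma quarter_turn_isotropic v : v *m quarter_turn *m v^T = 0.
Proof.
by apply/matrixP => i j; rewrite !ord1 !mxE !sum2 !mxE !sum2 !mxE /=; ring.
Qed.

Lemma antisym2 G : G + G^T = 0 -> G = G 0 1 *: quarter_turn.
Proof.
move=> /matrixP h; have := h 0 0; have := h 0 1; have := h 1 1.
by rewrite !mxE => h1 h2 h3; apply: matrix2P; rewrite !mxE /=; lra.
Qed.

Lemma positive_det G : G^T = G ->
  (forall v, v != 0 -> 0 < (v *m G *m v^T) 0 0) -> 0 < \det G.
Proof.
move=> /matrixP/(_ 0 1); rewrite mxE => s Gpos.
have := Gpos (delta_mx 0 0); rewrite -rowE !mxE sum2 !mxE /= mulr1 mulr0 addr0.
have d0 : delta_mx 0 0 != 0 :> 'rV[R]_2.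
  by apply/eqP => /rowP/(_ 0)/eqP; rewrite !mxE /= oner_eq0.
move=> /(_ d0) g0.
(* This vector is [G]-orthogonal to the first basis vector, and its square norm is
   [G 0 0 * \det G]. *)
pose v : 'rV[R]_2 := \row_i (if i == 0 then - G 0 1 else G 0 0).
have v0 : v != 0.
  by apply/eqP => /rowP/(_ 1); rewrite !mxE /= => e; rewrite e ltxx in g0.
have := Gpos v v0; rewrite !mxE sum2 !mxE !sum2 !mxE /= s.
rewrite (_ : _ + _ = G 0 0 * \det G); last by rewrite det2E s; ring.
by rewrite pmulr_rgt0.
Qed.

Lemma orthonormal_inv n (A G : 'M[R]_n) : A *m G *m A^T = 1%:M ->
  [/\ G *m A^T *m A = 1%:M, A^T *m A *m G = 1%:M & A \in unitmx].
Proof.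
move=> h; have u : A \in unitmx.
  by have [] := mulmx1_unit (etrans (mulmxA A G A^T) h).
have e : A^T *m (A *m G) = 1%:M.
  exact: mulmx1C.
split => //; last by rewrite -mulmxA.
by apply: mulmx1C; rewrite mulmxA.
Qed.

Lemma orthonormal_unique G B B' :
  B *m G *m B^T = 1%:M -> B' *m G *m B'^T = 1%:M -> row 0 B = row 0 B' ->
  0 < \det B -> 0 < \det B' -> B = B'.
Proof.
move=> hB hB' r0 dB dB'; have [i1 i2 uB] := orthonormal_inv hB.
(* [A] carries [B] to [B']. It is orthogonal, has positive determinant and fixes the first basis
   vector, so it is the identity. *)
have [A AE] : exists A, A = B' *m G *m B^T by eexists.
have AB : A *m B = B' by rewrite AE -!mulmxA [G *m _]mulmxA i1 mulmx1.
have AA : A *m A^T = 1%:M.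
  have := hB'; rewrite -AB trmx_mul.
  rewrite -!mulmxA [G *m _]mulmxA [B *m (_ *m _)]mulmxA.
  by rewrite [B *m (G *m _)]mulmxA hB mul1mx.
have A0 : row 0 A = row 0 1%:M.
  by rewrite AE !row_mul -r0 -!row_mul hB.
have a00 : A 0 0 = 1 by move/rowP/(_ 0): A0; rewrite !mxE.
have a01 : A 0 1 = 0 by move/rowP/(_ 1): A0; rewrite !mxE.
have dA : 0 < \det A.
  by move: dB'; rewrite -AB det_mulmx pmulr_lgt0.
move/matrixP: AA => AA; have := AA 0 1; have := AA 1 1.
rewrite !mxE !sum2 !mxE /= a00 a01 => e1 e2.
move: dA; rewrite det2E a00 a01 => dA.
have A1 : A = 1%:M.
  have a10 : A 1 0 = 0 by lra.
  apply: matrix2P; rewrite ?mxE //=.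
  by rewrite a10 in e1; nra.
by rewrite -AB A1 mul1mx.
Qed.

Lemma row0_col_mx v w : row 0 (col_mx v w : 'M[R]_2) = v.
Proof.
by apply/rowP => j; rewrite !mxE; case: splitP => // k _; rewrite ord1.
Qed.

Lemma det_col_mx v w :
  \det (col_mx v w : 'M[R]_2) = v 0 0 * w 0 1 - v 0 1 * w 0 0.
Proof.
rewrite det2E.
have e0 j : (col_mx v w : 'M[R]_2) 0 j = v 0 j.
  by rewrite mxE; case: splitP => // k _; rewrite ord1.
have e1 j : (col_mx v w : 'M[R]_2) 1 j = w 0 j.
  by rewrite mxE; case: splitP => [k|k _]; rewrite ?ord1 //; case: k => [[|]].
by rewrite !e0 !e1.
Qed.

Lemma col_mx_gram G v w : G^T = G -> v *m G *m v^T = 1%:M ->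
  v *m G *m w^T = 0 -> w *m G *m w^T = 1%:M ->
  (col_mx v w : 'M[R]_2) *m G *m (col_mx v w : 'M[R]_2)^T = 1%:M.
Proof.
move=> sG h1 h2 h3.
have h4 : w *m G *m v^T = 0.
  by rewrite -[LHS]trmx11 !trmx_mul trmxK sG mulmxA h2.
have : (col_mx v w : 'M[R]_(1 + 1, 2)) *m G *m (col_mx v w)^T = 1%:M.
  by rewrite tr_col_mx mul_col_mx mul_col_row h1 h2 h3 h4 -scalar_mx_block.
exact.
Qed.

(** The covector dual to [v], turned by a right angle and normalised by the area density. As an
    explicit expression in the metric and the velocity it can be differentiated along the curve,
    which the choice made in [normal_field] does not allow directly. *)
Definition normal_vector G v : 'rV[R]_2 :=
  (Num.sqrt (\det G))^-1 *: (v *m G *m quarter_turn).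

Lemma normal_vectorP G v : G^T = G -> 0 < \det G -> v *m G *m v^T = 1%:M ->
  [/\ v *m G *m (normal_vector G v)^T = 0,
      normal_vector G v *m G *m (normal_vector G v)^T = 1%:M &
      0 < \det (col_mx v (normal_vector G v) : 'M[R]_2)].
Proof.
move=> sG dG v1; rewrite /normal_vector; set s := Num.sqrt _.
have s0 : 0 < s by rewrite sqrtr_gt0.
have ss : s ^+ 2 = \det G by rewrite sqr_sqrtr // ltW.
rewrite !linearZ /= !trmx_mul sG.
split.
- have wE : G *m v^T = (v *m G)^T by rewrite trmx_mul sG.
  rewrite wE; move: (v *m G) => w.
  by rewrite -[w *m _]trmx11 !trmx_mul !trmxK quarter_turn_isotropic scaler0.
- rewrite -!scalemxAl scalerA -!mulmxA.
  rewrite [quarter_turn *m (G *m _)]mulmxA [quarter_turn *m G *m (_ *m _)]mulmxA.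
  rewrite [_ *m quarter_turn^T *m (G *m _)]mulmxA quarter_turn_metric //.
  rewrite mul_scalar_mx -!scalemxAr scalerA mulmxA v1 -ss.
  by rewrite -expr2 exprVn mulVf ?scale1r // expf_neq0 // gt_eqF.
- rewrite det_col_mx (_ : _ - _ = s^-1 * (v *m G *m v^T) 0 0); last first.
    by rewrite !mxE !sum2 !mxE /=; ring.
  by rewrite v1 mxE mulr1 invr_gt0.
Qed.

End plane_linear_algebra.

(** * Curves in charts *)

Section curve_in_charts.
Context {R : realType} {n : nat} {M : riemannian R n} (tau : R) (x : R -> M).
Hypotheses (tau_gt0 : 0 < tau) (x_C2 : Ck_curve tau 2 x).
Implicit Types (i j : chart_index M) (t : R).

Definition speed i t : 'rV[R]_n := der tau (chart i \o x) t.
Definition acceleration i t : 'rV[R]_n := der tau (speed i) t.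
Definition gram_along i t : 'M[R]_n := metric i (chart i (x t)).

Lemma curve_cont_in t : t \in `[0, tau] -> cont_in tau x t.
Proof.
by move=> tI; have [/subspace_continuousP/(_ t) h _] := x_C2; apply: h.
Qed.

Lemma times_near i t : t \in `[0, tau] -> dom i (x t) ->
  \forall s \near t, s \in `[0, tau] -> dom i (x s).
Proof.
move=> tI it; apply: cont_in_nbhs (curve_cont_in tI) _.
by apply: open_nbhs_nbhs; split => //; exact: dom_open.
Qed.

Lemma chart_has_der i t : t \in `[0, tau] -> dom i (x t) ->
  has_der tau (chart i \o x) t (speed i t).
Proof.
move=> tI it; apply: derivable_inP; have [_ /(_ i)[h _]] := x_C2.
by apply: h.
Qed.

Lemma speed_has_der i t : t \in `[0, tau] -> dom i (x t) ->
  has_der tau (speed i) t (acceleration i t).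
Proof.
move=> tI it; apply: derivable_inP; have [_ /(_ i)[_ [h _]]] := x_C2.
by apply: h.
Qed.

Lemma acceleration_cont i t : t \in `[0, tau] -> dom i (x t) ->
  cont_in tau (acceleration i) t.
Proof.
move=> tI it; have [_ /(_ i)[_ [_ h]]] := x_C2.
have hsub : times tau (@dom R n M) x i `<=` `[0, tau] by move=> s [].
have hnear s : times tau (@dom R n M) x i s ->
    \forall r \near s, r \in `[0, tau] -> times tau (@dom R n M) x i r.
  move=> [sI si]; apply: filterS (times_near sI si) => r ri rI.
  by split => //; exact: ri.
by have [h' _] := cont_in_within (der tau (der tau (chart i \o x))) hsub hnear; apply: h'.
Qed.

Lemma speed_change i j t : t \in `[0, tau] -> dom i (x t) -> dom j (x t) ->
  speed j t = speed i t *m transition i j (x t).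
Proof.
move=> tI it jt; have ci := chart_has_der tI it.
have df := transition_differentiable it jt.
have h := has_der_comp df ci.
have e : \forall s \near t, s \in `[0, tau] ->
    ((chart j \o unchart i) \o (chart i \o x)) s = (chart j \o x) s.
  by apply: filterS (times_near tI it) => s si ss /=; rewrite chartK //; exact: si.
have {}h := has_der_near_eq tI e h.
rewrite (has_der_unique tau_gt0 tI (chart_has_der tI jt) h).
by apply: etrans (esym (mulmx_transition _ it jt)); rewrite deriveE.
Qed.

Lemma velocity_components i t : t \in `[0, tau] -> dom i (x t) ->
  components i (x t) (velocity tau x t) = speed i t.
Proof.
by move=> tI it; rewrite (speed_change tI _ it (i := chart_at (x t))) //;
  exact: dom_chart_at.
Qed.

Lemma gram_has_der i t : t \in `[0, tau] -> dom i (x t) ->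
  has_der tau (gram_along i) t ('D_(speed i t) (metric i) (chart i (x t))).
Proof. by move=> tI it; exact: has_der_metric it erefl (chart_has_der tI it). Qed.

Lemma chart_along_cont i t : t \in `[0, tau] -> dom i (x t) ->
  cont_in tau (chart i \o x) t.
Proof. by move=> tI it; exact: has_der_continuous (chart_has_der tI it). Qed.

Lemma dmetric_along_cont i t a b c : t \in `[0, tau] -> dom i (x t) ->
  cont_in tau (fun s => dmetric i a b c (chart i (x s))) t.
Proof.
move=> tI it.
have c1 : cont_in tau ('D_(delta_mx 0 a) (metric i) \o (chart i \o x)) t.
  apply: cont_in_comp; last exact: chart_along_cont.
  exact: metric_derive_continuous.
have /cont_in_mxP/(_ b c) c2 := c1; apply: (cont_in_near tI _ c2).
apply: filterS (times_near tI it) => s si ss /=.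
by rewrite dmetricE //; exact: si.
Qed.

Lemma cont_in_mulr (f g : R -> R) t :
  cont_in tau f t -> cont_in tau g t -> cont_in tau (fun s => f s * g s) t.
Proof. exact: cvgM. Qed.

Lemma cont_in_add (V : normedModType R) (f g : R -> V) t :
  cont_in tau f t -> cont_in tau g t -> cont_in tau (fun s => f s + g s) t.
Proof. exact: cvgD. Qed.

Lemma cont_in_sum (I : Type) (r : seq I) (f : I -> R -> R) t :
  (forall k, cont_in tau (f k) t) -> cont_in tau (fun s => \sum_(k <- r) f k s) t.
Proof.
move=> h; elim: r => [|i r IH].
  rewrite (_ : (fun s => _) = cst 0); first exact: cont_in_cst.
  by apply/funext => s; rewrite big_nil.
rewrite (_ : (fun s => _) = fun s => f i s + \sum_(j <- r) f j s).
  exact: cont_in_add.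
by apply/funext => s; rewrite big_cons.
Qed.

Lemma cont_in_opp (V : normedModType R) (f : R -> V) t :
  cont_in tau f t -> cont_in tau (fun s => - f s) t.
Proof. exact: cvgN. Qed.

Definition koszul_along i t := koszul_mx i (chart i (x t)) (speed i t).
Definition connection_along i t := connection_mx i (chart i (x t)) (speed i t).

Lemma koszul_along_cont i t : t \in `[0, tau] -> dom i (x t) ->
  cont_in tau (koszul_along i) t.
Proof.
move=> tI it; have /cont_in_mxP vc := has_der_continuous (speed_has_der tI it).
apply/cont_in_mxP => b m.
pose S (d : 'I_n -> R -> R) s := \sum_a speed i s 0 a * d a s.
have Sc d : (forall a, cont_in tau (d a) t) -> cont_in tau (S d) t.
  by move=> dc; apply: cont_in_sum => a; apply: cont_in_mulr.
pose D a b c s := dmetric i a b c (chart i (x s)).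
rewrite (_ : (fun s => _) = fun s => 2^-1 * (S (fun a => D a b m) s +
  S (fun a => D b a m) s - S (fun a => D m a b) s)); last first.
  by apply/funext => s; rewrite !mxE.
apply: cont_in_mulr; first exact: cont_in_cst.
apply: cont_in_add; last apply: cont_in_opp.
  by apply: cont_in_add; apply: Sc => a; exact: dmetric_along_cont.
by apply: Sc => a; exact: dmetric_along_cont.
Qed.

Lemma connection_koszul i t : dom i (x t) ->
  connection_along i t *m gram_along i t = koszul_along i t.
Proof. exact: connection_mx_metric. Qed.

End curve_in_charts.

(** * The Darboux frame *)

(** Invariance of [<D_T T, N>] under a change of chart, with [HT] and [HN] the second derivatives of
    the change. One term in [HT] is the inhomogeneous part of the acceleration. The other is
    cancelled by the two halved terms in [HN], each equal to it by [T HN = N HT], the symmetry of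
    second derivatives. *)
Lemma curvature_algebra (R : realType) n (T N A Tj Nj Aj : 'rV[R]_n)
    (Gi Gj J HT HN DTi DNi DTj DNj : 'M[R]_n) :
  Gj^T = Gj -> Gi = J *m Gj *m J^T -> T *m HN = N *m HT ->
  Tj = T *m J -> Nj = N *m J -> Aj = A *m J + T *m HT ->
  DTi = HT *m Gj *m J^T + J *m DTj *m J^T + J *m Gj *m HT^T ->
  DNi = HN *m Gj *m J^T + J *m DNj *m J^T + J *m Gj *m HN^T ->
  A *m Gi *m N^T + (T *m DTi *m N^T - 2^-1 *: (T *m DNi *m T^T)) =
  Aj *m Gj *m Nj^T + (Tj *m DTj *m Nj^T - 2^-1 *: (Tj *m DNj *m Tj^T)).
Proof.
move=> sG -> e -> -> -> -> ->.
have tr1 (X : 'M[R]_1) : X^T = X by apply/matrixP => a b; rewrite mxE !ord1.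
have e' : HN^T *m T^T = HT^T *m N^T by rewrite -!trmx_mul e.
rewrite !mulmxDr !mulmxDl !trmx_mul !mulmxA.
have a1 : T *m HN *m Gj *m J^T *m T^T = T *m J *m Gj *m HT^T *m N^T.
  by rewrite e -[LHS]tr1 !trmx_mul !trmxK sG !mulmxA.
have a2 : T *m J *m Gj *m HN^T *m T^T = T *m J *m Gj *m HT^T *m N^T.
  by rewrite -!mulmxA e'.
rewrite a1 a2.
move: (T *m J *m Gj *m HT^T *m N^T) (A *m J *m Gj *m J^T *m N^T)
  (T *m HT *m Gj *m J^T *m N^T) (T *m J *m DTj *m J^T *m N^T)
  (T *m J *m DNj *m J^T *m T^T) => X1 X2 X3 X4 X5.
by apply/matrixP => p q; rewrite !mxE; field.
Qed.

Section darboux_frame.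
Context {R : realType} {M : surface R} (tau : R) (x : R -> M).
Hypotheses (tau_gt0 : 0 < tau) (x_C2 : Ck_curve tau 2 x).
Hypothesis x_unit : arc_length_param tau x.
Implicit Types (i j : chart_index M) (t : R).

Local Notation speed := (speed tau x).
Local Notation acceleration := (acceleration tau x).
Local Notation gram_along := (gram_along x).
Local Notation koszul_along := (koszul_along tau x).
Local Notation connection_along := (connection_along tau x).

Definition normal i t : 'rV[R]_2 := normal_vector (gram_along i t) (speed i t).
Definition darboux i t : 'M[R]_2 := col_mx (speed i t) (normal i t).

Lemma gram_along_sym i t : dom i (x t) -> (gram_along i t)^T = gram_along i t.
Proof. exact: metric_symm. Qed.

Lemma gram_change i j t : dom i (x t) -> dom j (x t) ->
  gram_along i t = transition i j (x t) *m gram_along j t *m (transition i j (x t))^T.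
Proof. exact: metric_transition. Qed.

Lemma gram_det_gt0 i t : dom i (x t) -> 0 < \det (gram_along i t).
Proof.
move=> it; apply: positive_det; first exact: gram_along_sym.
by apply: metric_pos; exists (x t).
Qed.

Lemma speed_unit i t : t \in `[0, tau] -> dom i (x t) ->
  speed i t *m gram_along i t *m (speed i t)^T = 1%:M.
Proof.
move=> tI it; have jt := dom_chart_at (x t); set j := chart_at (x t) in jt.
have := x_unit tI; rewrite /inner => u.
have {}u : speed j t *m gram_along j t *m (speed j t)^T = 1%:M.
  by apply/matrixP => a b; rewrite !ord1 [RHS]mxE -u.
rewrite (gram_change jt it) in u; rewrite (speed_change tau_gt0 x_C2 tI jt it).
by rewrite trmx_mul -!mulmxA; rewrite -!mulmxA in u.
Qed.

Lemma darboux_gram i t : t \in `[0, tau] -> dom i (x t) ->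
  darboux i t *m gram_along i t *m (darboux i t)^T = 1%:M.
Proof.
move=> tI it; have sG := gram_along_sym it; have u := speed_unit tI it.
have [h1 h2 _] := normal_vectorP sG (gram_det_gt0 it) u.
exact: col_mx_gram.
Qed.

Lemma darboux_det i t : t \in `[0, tau] -> dom i (x t) -> 0 < \det (darboux i t).
Proof.
move=> tI it; have sG := gram_along_sym it; have u := speed_unit tI it.
by have [_ _] := normal_vectorP sG (gram_det_gt0 it) u.
Qed.

Lemma gram_change_frame i j t (B : 'M[R]_2) : dom i (x t) -> dom j (x t) ->
  B *m gram_along i t *m B^T = 1%:M ->
  (B *m transition i j (x t)) *m gram_along j t *m
    (B *m transition i j (x t))^T = 1%:M.
Proof.
move=> it jt; rewrite (gram_change it jt) trmx_mul -!mulmxA; exact.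
Qed.

(** Coordinate changes preserve orientation, so both sides are positive orthonormal frames with the
    same first vector, and in dimension two this determines them. *)
Lemma darboux_change i j t : t \in `[0, tau] -> dom i (x t) -> dom j (x t) ->
  darboux j t = darboux i t *m transition i j (x t).
Proof.
move=> tI it jt; apply: (@orthonormal_unique _ (gram_along j t)).
- exact: darboux_gram.
- exact: gram_change_frame (darboux_gram tI it).
- by rewrite row_mul !row0_col_mx (speed_change tau_gt0 x_C2 tI it jt).
- exact: darboux_det.
- rewrite det_mulmx mulr_gt0 //; first exact: darboux_det.
  exact: transition_oriented.
Qed.

Lemma normal_change i j t : t \in `[0, tau] -> dom i (x t) -> dom j (x t) ->
  normal j t = normal i t *m transition i j (x t).
Proof.
move=> tI it jt.
have e := @mul_col_mx R 1 1 2 2 (speed i t) (normal i t) (transition i j (x t)).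
by have /(@eq_col_mx _ 1 1 2)[] := etrans (darboux_change tI it jt) e.
Qed.

Lemma acceleration_change i j t : t \in `[0, tau] -> dom i (x t) -> dom j (x t) ->
  acceleration j t = acceleration i t *m transition i j (x t) +
    speed i t *m hessian i j (x t) (speed i t).
Proof.
move=> tI it jt.
have hJ := has_der_transition tI it jt erefl (chart_has_der x_C2 tI it).
have h := has_der_mulmx (speed_has_der x_C2 tI it) hJ.
have e : \forall s \near t, s \in `[0, tau] ->
    speed i s *m jacobian (chart j \o unchart i) (chart i (x s)) = speed j s.
  apply: filterS2 (times_near x_C2 tI it) (times_near x_C2 tI jt) => s si sj ss.
  by rewrite (speed_change tau_gt0 x_C2 ss (si ss) (sj ss)).
have {}h := has_der_near_eq tI e h.
exact: (has_der_unique tau_gt0 tI (speed_has_der x_C2 tI jt) h).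
Qed.

(** [<D_T T, N>] in the chart [i], with the connection in lowered form. *)
Definition curvature_in i t : R :=
  ((acceleration i t *m gram_along i t + speed i t *m koszul_along i t) *m
    (normal i t)^T) 0 0.

Lemma curvature_inE i t : dom i (x t) -> curvature_in i t =
  (acceleration i t *m gram_along i t *m (normal i t)^T +
    (speed i t *m 'D_(speed i t) (metric i) (chart i (x t)) *m (normal i t)^T -
     2^-1 *: (speed i t *m 'D_(normal i t) (metric i) (chart i (x t)) *m
       (speed i t)^T))) 0 0.
Proof.
move=> it; apply: (congr1 (fun X : 'M[R]_1 => X 0 0)).
apply: etrans (mulmxDl _ _ _) _; apply: (congr1 (fun X => _ + X)).
exact: koszul_quadratic.
Qed.

Lemma curvature_change i j t : t \in `[0, tau] -> dom i (x t) -> dom j (x t) ->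
  curvature_in i t = curvature_in j t.
Proof.
move=> tI it jt; apply: etrans (curvature_inE it) (etrans _ (esym (curvature_inE jt))).
apply: (congr1 (fun X : 'M[R]_1 => X 0 0)).
have eT := speed_change tau_gt0 x_C2 tI it jt.
have eN := normal_change tI it jt.
apply: (curvature_algebra (gram_along_sym jt) (gram_change it jt)
  (DTi := 'D_(speed i t) (metric i) (chart i (x t)))
  (DNi := 'D_(normal i t) (metric i) (chart i (x t)))
  (hessian_sym (speed i t) (normal i t) it jt) eT eN
  (acceleration_change tI it jt)).
- rewrite eT; exact: (metric_derive_change (speed i t) it jt).
- rewrite eN; exact: (metric_derive_change (normal i t) it jt).
Qed.

End darboux_frame.

Lemma has_der_comp1 (R : realType) (tau : R) (f : R -> R) (g : R -> R) t d f' :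
  is_derive (g t) 1 f f' -> has_der tau g t d -> has_der tau (f \o g) t (d * f').
Proof.
move=> [fd fE] gd; have df : differentiable f (g t) by apply/derivable1_diffP.
have := has_der_comp df gd.
by rewrite -[X in 'd f _ X]mulr1 [d * 1]/(d *: 1) linearZ /= -deriveE // fE.
Qed.

(** * Rotations by an angle *)

Section rotations.
Context {R : realType}.

Definition direction (a : R) : 'rV[R]_2 := \row_k (if k == 0 then cos a else sin a).
(** The rotation by [- a], as a combination of the identity and the quarter turn, so that its
    derivative is again a multiple of itself turned by a right angle. *)
Definition back_rotation (a : R) : 'M[R]_2 := cos a *: 1%:M - sin a *: quarter_turn.

Lemma direction_back_rotation a : direction a *m back_rotation a = delta_mx 0 0.
Proof.
rewrite /direction /back_rotation.
move: (cos a) (sin a) (cos2Dsin2 a) => c s cs; apply/rowP => k.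
by case: (ord2P k) => ->; rewrite !mxE sum2 !mxE /=; lra.
Qed.

Lemma back_rotation_orthogonal a : back_rotation a *m (back_rotation a)^T = 1%:M.
Proof.
rewrite /back_rotation; move: (cos a) (sin a) (cos2Dsin2 a) => c s cs.
by apply: matrix2P; rewrite !mxE !sum2 !mxE /=; lra.
Qed.

Lemma back_rotation_det a : \det (back_rotation a) = 1.
Proof.
rewrite /back_rotation det2E; move: (cos a) (sin a) (cos2Dsin2 a) => c s cs.
by rewrite !mxE /=; lra.
Qed.

Lemma back_rotation_has_der tau phi t k : has_der tau phi t k ->
  has_der tau (fun s => back_rotation (phi s)) t
    (- k *: (back_rotation (phi t) *m quarter_turn)).
Proof.
move=> h; have hc := has_der_comp1 (is_derive_cos (phi t)) h.
have hs := has_der_comp1 (is_derive_sin (phi t)) h.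
have h1 := has_der_scalemx hc (has_der_cst tau (1%:M : 'M[R]_2) t).
have h2 := has_der_scalemx hs (has_der_cst tau (- quarter_turn) t).
have := has_derD h1 h2.
rewrite (_ : (fun s => _) = fun s => back_rotation (phi s)); last first.
  by apply/funext => s; rewrite /back_rotation /= scalerN.
rewrite [X in has_der _ _ _ X](_ : _ = - k *: (back_rotation (phi t) *m quarter_turn)) //.
apply: matrix2P; rewrite !mxE !sum2 !mxE /=; ring.
Qed.

End rotations.

Lemma row1_col_mx (R : realType) (v w : 'rV[R]_2) : row 1 (col_mx v w : 'M[R]_2) = w.
Proof.
apply/rowP => j; rewrite !mxE; by case: splitP => [[[|]]//|k _]; rewrite ord1.
Qed.

Lemma col_mx2E (R : realType) (v w : 'rV[R]_2) a b :
  (col_mx v w : 'M[R]_2) a b = if a == 0 then v 0 b else w 0 b.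
Proof.
case: (ord2P a) => -> /=.
  by have /rowP/(_ b) := row0_col_mx v w; rewrite mxE.
by have /rowP/(_ b) := row1_col_mx v w; rewrite mxE.
Qed.

Lemma has_der_col_mx (R : realType) tau (f g : R -> 'rV[R]_2) t f' g' :
  has_der tau f t f' -> has_der tau g t g' ->
  has_der tau (fun s => col_mx (f s) (g s) : 'M[R]_2) t (col_mx f' g').
Proof.
move=> /has_der_mxP hf /has_der_mxP hg; apply/has_der_mxP => a b.
rewrite (_ : (fun s => _) = fun s => if a == 0 then f s 0 b else g s 0 b).
  by rewrite (col_mx2E f' g'); case: (a == 0); [exact: hf|exact: hg].
by apply/funext => s; rewrite col_mx2E.
Qed.

Lemma mulmx_gram_entry (R : realType) n (X G B : 'M[R]_n) a b :
  (X *m G *m B^T) a b = (row a X *m G *m (row b B)^T) 0 0.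
Proof.
rewrite mxE [RHS]mxE; apply: eq_bigr => k _; rewrite -row_mul.
by rewrite !mxE.
Qed.

(** If [B' = D] and [G' = C G + G C^T], the right-hand side is the derivative of [B G B^T]. It
    vanishes for an orthonormal frame, so the matrix symmetrised on the left is then
    antisymmetric. *)
Lemma symmetrized_derivative (R : realType) n (D B G C : 'M[R]_n) : G^T = G ->
  (D + B *m C) *m G *m B^T + ((D + B *m C) *m G *m B^T)^T =
  (D *m G + B *m (C *m G + G *m C^T)) *m B^T + B *m G *m D^T.
Proof.
move=> sG; rewrite !trmx_mul trmxK linearD /= trmx_mul sG.
rewrite !mulmxDr !mulmxDl !mulmxA.
by rewrite -!addrA; congr (_ + (_ + _)); rewrite addrC.
Qed.

(** * The structure equations of the Darboux frame *)

Section structure_equations.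
Context {R : realType} {M : surface R} (tau : R) (x : R -> M).
Hypotheses (tau_gt0 : 0 < tau) (x_C2 : Ck_curve tau 2 x).
Hypothesis x_unit : arc_length_param tau x.
Implicit Types (i j : chart_index M) (t : R).

Local Notation speed := (speed tau x).
Local Notation acceleration := (acceleration tau x).
Local Notation gram_along := (gram_along x).
Local Notation koszul_along := (koszul_along tau x).
Local Notation connection_along := (connection_along tau x).
Local Notation normal := (normal tau x).
Local Notation darboux := (darboux tau x).
Local Notation curvature_in := (curvature_in tau x).

(** Existence is all that is extracted: orthonormality will determine the derivative without
    computing it. *)
Lemma normal_has_der i t : t \in `[0, tau] -> dom i (x t) ->
  exists D, has_der tau (normal i) t D.
Proof.
move=> tI it; have hG := gram_has_der x_C2 tI it; set G' := 'D_(_) _ _ in hG.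
have hT := speed_has_der x_C2 tI it.
have /has_der_mxP hGe := hG.
have hd := has_derD (has_derM (hGe 0 0) (hGe 1 1))
  (has_derM (has_derM (has_der_cst tau (-1 : R) t) (hGe 0 1)) (hGe 1 0)).
set d' := (X in has_der _ _ _ X) in hd.
have {}hd : has_der tau (fun s => \det (gram_along i s)) t d'.
  rewrite (_ : (fun s => _) = fun s => gram_along i s 0 0 * gram_along i s 1 1 +
    cst (-1) s * gram_along i s 0 1 * gram_along i s 1 0) //.
  by apply/funext => s; rewrite det2E /= mulN1r mulNr.
have d0 := gram_det_gt0 it.
have s0 : Num.sqrt (\det (gram_along i t)) != 0 by rewrite gt_eqF // sqrtr_gt0.
have hs := has_der_comp1 (is_derive1_sqrt d0) hd.
have dI : differentiable (GRing.inv : R -> R) (Num.sqrt (\det (gram_along i t))).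
  exact: differentiable_Rinv.
have hv := @has_der_comp R tau R R GRing.inv
  (fun s => Num.sqrt (\det (gram_along i s))) t _ dI hs.
have hq := has_der_mulmxr quarter_turn (has_der_mulmx hT hG).
by eexists; exact: has_der_scalemx hv hq.
Qed.

(** [S] below expresses the covariant derivative of the frame in the frame itself. It is
    antisymmetric, hence a multiple of the quarter turn, and its entry [S 0 1], the normal component
    of the covariant acceleration, is the curvature. *)
Lemma darboux_has_der i t : t \in `[0, tau] -> dom i (x t) ->
  has_der tau (darboux i) t (curvature_in i t *: (quarter_turn *m darboux i t) -
    darboux i t *m connection_along i t).
Proof.
move=> tI it; have [N' hN] := normal_has_der tI it.
have hT := speed_has_der x_C2 tI it.
pose D : 'M[R]_2 := col_mx (acceleration i t) N'.
have hB : has_der tau (darboux i) t D.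
  exact: has_der_col_mx.
have hG := gram_has_der x_C2 tI it; set G' := 'D_(_) _ _ in hG.
have h := has_der_mulmx (has_der_mulmx hB hG) (has_der_trmx hB).
have e : \forall s \near t, s \in `[0, tau] ->
    darboux i s *m gram_along i s *m (darboux i s)^T = 1%:M.
  apply: filterS (times_near x_C2 tI it) => s si ss.
  exact: darboux_gram (si ss).
have {h e} := has_der_near_eq tI e h.
move/(has_der_unique tau_gt0 tI (has_der_cst tau (1%:M : 'M[R]_2) t)).
rewrite /G' -(connection_compat _ it) => e.
have sG := gram_along_sym it; have BG := darboux_gram tau_gt0 x_C2 x_unit tI it.
have [i1 i2 uB] := orthonormal_inv BG.
have K := connection_koszul tau it.
pose S := (D + darboux i t *m connection_along i t) *m gram_along i t *m (darboux i t)^T.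
have k0 : curvature_in i t = S 0 1.
  have r0 : row 0 (D + darboux i t *m connection_along i t) =
      acceleration i t + speed i t *m connection_along i t.
    by rewrite linearD /= row_mul !row0_col_mx.
  by rewrite /S mulmx_gram_entry r0 row1_col_mx mulmxDl -mulmxA K.
have SE : S = curvature_in i t *: quarter_turn.
  by rewrite k0; apply: antisym2; rewrite [RHS]e; exact: symmetrized_derivative.
have : S *m darboux i t = D + darboux i t *m connection_along i t.
  by rewrite /S -mulmxA -mulmxA [gram_along i t *m _]mulmxA i1 mulmx1.
rewrite SE -scalemxAl => ->; rewrite addrK; exact: hB.
Qed.

End structure_equations.

(** * The parallel frame *)

Section parallel_frame.
Context {R : realType} {M : surface R} (tau : R) (x : R -> M).
Hypotheses (tau_gt0 : 0 < tau) (x_C2 : Ck_curve tau 2 x).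
Hypothesis x_unit : arc_length_param tau x.
Implicit Types (i j : chart_index M) (t : R).

Local Notation speed := (speed tau x).
Local Notation acceleration := (acceleration tau x).
Local Notation gram_along := (gram_along x).
Local Notation koszul_along := (koszul_along tau x).
Local Notation connection_along := (connection_along tau x).
Local Notation normal := (normal tau x).
Local Notation darboux := (darboux tau x).
Local Notation curvature_in := (curvature_in tau x).
Local Notation kg := (geodesic_curvature tau x).

Lemma gram_cont i t : t \in `[0, tau] -> dom i (x t) -> cont_in tau (gram_along i) t.
Proof. by move=> tI it; exact: has_der_continuous (gram_has_der x_C2 tI it). Qed.

Lemma speed_cont i t : t \in `[0, tau] -> dom i (x t) -> cont_in tau (speed i) t.
Proof. by move=> tI it; exact: has_der_continuous (speed_has_der x_C2 tI it). Qed.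

Lemma curvature_cont i t : t \in `[0, tau] -> dom i (x t) ->
  cont_in tau (curvature_in i) t.
Proof.
move=> tI it; have [N' hN] := normal_has_der x_C2 tI it.
have cN := has_der_continuous hN.
have c1 := cont_in_mulmx (acceleration_cont x_C2 tI it) (gram_cont tI it).
have c2 := cont_in_mulmx (speed_cont tI it) (koszul_along_cont x_C2 tI it).
have c3 := cont_in_mulmx (cont_in_add c1 c2) (cont_in_trmx cN).
by move/cont_in_mxP: c3 => /(_ 0 0).
Qed.

Lemma normal_fieldE t : t \in `[0, tau] ->
  normal_field tau x t = normal (chart_at (x t)) t.
Proof.
move=> tI; have jt := dom_chart_at (x t); set j := chart_at (x t) in jt *.
have sG := gram_along_sym jt; have u := speed_unit tau_gt0 x_C2 x_unit tI jt.
have [n1 n2 n3] := normal_vectorP sG (gram_det_gt0 jt) u.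
rewrite /normal_field; apply: xget_unique.
  by split => //; [rewrite /inner (_ : _ *m _ = 1%:M) ?mxE // |
    rewrite /inner (_ : _ *m _ = 0) ?mxE // |
    rewrite /inner (_ : _ *m _ = 1%:M) ?mxE //].
move=> w [w1 w2 w3 w4].
have e (X : 'M[R]_1) (c : R) : X 0 0 = c -> X = c%:M.
  by move=> <-; apply/matrixP => a b; rewrite !ord1 mxE eqxx.
have h2 : speed j t *m gram_along j t *m w^T = 0.
  by rewrite -[RHS](raddf0 (@scalar_mx R 1)); exact: e.
have h3 : w *m gram_along j t *m w^T = 1%:M by exact: e.
have := @orthonormal_unique R (gram_along j t) (col_mx (speed j t) w)
  (darboux j t) (col_mx_gram sG u h2 h3)
  (darboux_gram tau_gt0 x_C2 x_unit tI jt) _ w4 _.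
rewrite !row0_col_mx => /(_ erefl (darboux_det tau_gt0 x_C2 x_unit tI jt)).
by move=> /(congr1 (row 1)); rewrite !row1_col_mx.
Qed.

Lemma covariant_derivative_velocity t : t \in `[0, tau] ->
  let j := chart_at (x t) in
  covariant_derivative tau x (velocity tau x) t =
  acceleration j t + speed j t *m connection_along j t.
Proof.
move=> tI j; have jt := dom_chart_at (x t).
rewrite /covariant_derivative christoffel_formE; apply: (congr1 (+%R^~ _)).
have h := speed_has_der x_C2 tI jt.
have e : \forall s \near t, s \in `[0, tau] ->
    speed j s = components j (x s) (velocity tau x s).
  apply: filterS (times_near x_C2 tI jt) => s sj ss.
  by rewrite (velocity_components tau_gt0 x_C2 ss (sj ss)).
by have [_ ->] := has_derE tau_gt0 tI (has_der_near_eq tI e h).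
Qed.

Lemma geodesic_curvatureE i t : t \in `[0, tau] -> dom i (x t) ->
  kg t = curvature_in i t.
Proof.
move=> tI it; have jt := dom_chart_at (x t); set j := chart_at (x t) in jt.
rewrite (curvature_change tau_gt0 x_C2 x_unit tI it jt).
rewrite /geodesic_curvature normal_fieldE // covariant_derivative_velocity //.
apply: (congr1 (fun X : 'M[R]_1 => X 0 0)).
apply: (congr1 (fun X => X *m (normal j t)^T)).
apply: etrans (mulmxDl _ _ _) _; apply: (congr1 (fun X => _ + X)).
by rewrite -(connection_koszul tau jt) mulmxA.
Qed.

Lemma geodesic_curvature_cont t : t \in `[0, tau] -> cont_in tau kg t.
Proof.
move=> tI; have jt := dom_chart_at (x t).
apply: (cont_in_near tI _ (curvature_cont tI jt)).
apply: filterS (times_near x_C2 tI jt) => s sj ss.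
by rewrite (geodesic_curvatureE ss (sj ss)).
Qed.

Definition phase t : R := \int[lebesgue_measure]_(s in `[0, t]) kg s.

Lemma phase_has_der t : t \in `[0, tau] -> has_der tau phase t (kg t).
Proof. by move=> tI; apply: has_der_primitive => // s; exact: geodesic_curvature_cont. Qed.

Lemma phase0 : phase 0 = 0.
Proof. by rewrite /phase set_itv1 Rintegral_set1. Qed.

(* Rotating the Darboux frame back by the accumulated geodesic curvature makes it
   parallel. *)
Definition frame i t : 'M[R]_2 := back_rotation (phase t) *m darboux i t.

Lemma frame_gram i t : t \in `[0, tau] -> dom i (x t) ->
  frame i t *m gram_along i t *m (frame i t)^T = 1%:M.
Proof.
move=> tI it; rewrite /frame trmx_mul.
have BG := darboux_gram tau_gt0 x_C2 x_unit tI it.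
rewrite -!mulmxA; rewrite -mulmxA in BG.
by rewrite [gram_along i t *m _]mulmxA [darboux i t *m _]mulmxA BG mul1mx
  back_rotation_orthogonal.
Qed.

Lemma frame_det i t : t \in `[0, tau] -> dom i (x t) -> 0 < \det (frame i t).
Proof.
by move=> tI it; rewrite det_mulmx back_rotation_det mul1r darboux_det.
Qed.

Lemma frame_change i j t : t \in `[0, tau] -> dom i (x t) -> dom j (x t) ->
  frame j t = frame i t *m transition i j (x t).
Proof.
move=> tI it jt; rewrite /frame (darboux_change tau_gt0 x_C2 x_unit tI it jt).
by rewrite mulmxA.
Qed.

Lemma speed_frame i t : speed i t = direction (phase t) *m frame i t.
Proof.
by rewrite /frame mulmxA direction_back_rotation -rowE row0_col_mx.
Qed.

(** The derivative of the rotation contributes [- kg] times the turned frame, which cancels the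
    curvature term of the structure equations. *)
Lemma frame_has_der i t : t \in `[0, tau] -> dom i (x t) ->
  has_der tau (frame i) t (- (frame i t *m connection_along i t)).
Proof.
move=> tI it; have hR := back_rotation_has_der (phase_has_der tI).
have hB := darboux_has_der tau_gt0 x_C2 x_unit tI it.
have := has_der_mulmx hR hB; rewrite (geodesic_curvatureE tI it).
rewrite [X in has_der _ _ _ X -> _](_ : _ = - (frame i t *m connection_along i t)) //.
rewrite /frame.
move: (back_rotation _) (curvature_in i t) (darboux i t) (connection_along i t).
move=> B k D C; rewrite mulmxBr -scalemxAl -scalemxAr !mulmxA scaleNr.
by rewrite addrA addNr add0r.
Qed.

(** The inverse of the frame, written through orthonormality as a product that can be
    differentiated. The entries of [v *m coframe i t] are the inner products of [v] with the frame
    vectors. *)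
Definition coframe i t : 'M[R]_2 := gram_along i t *m (frame i t)^T.

Lemma frame_coframe i t : t \in `[0, tau] -> dom i (x t) ->
  frame i t *m coframe i t = 1%:M.
Proof. by move=> tI it; rewrite mulmxA frame_gram. Qed.

Lemma coframe_frame i t : t \in `[0, tau] -> dom i (x t) ->
  coframe i t *m frame i t = 1%:M.
Proof. by move=> tI it; apply: mulmx1C; exact: frame_coframe. Qed.

Lemma coframe_change i j t : t \in `[0, tau] -> dom i (x t) -> dom j (x t) ->
  transition i j (x t) *m coframe j t = coframe i t.
Proof.
move=> tI it jt; rewrite -[LHS]mul1mx -(coframe_frame tI it) -mulmxA.
rewrite [frame i t *m _]mulmxA -(frame_change tI it jt) frame_coframe //.
by rewrite mulmx1.
Qed.

Lemma coframe_has_der i t : t \in `[0, tau] -> dom i (x t) ->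
  has_der tau (coframe i) t (connection_along i t *m coframe i t).
Proof.
move=> tI it; have hG := gram_has_der x_C2 tI it.
have h := has_der_mulmx hG (has_der_trmx (frame_has_der tI it)).
have e : connection_along i t *m gram_along i t + gram_along i t *m
  (connection_along i t)^T = 'D_(speed i t) (metric i) (chart i (x t)).
  exact: connection_compat.
rewrite (_ : _ *m _ = 'D_(speed i t) (metric i) (chart i (x t)) *m (frame i t)^T +
  gram_along i t *m (- (frame i t *m connection_along i t))^T) //.
rewrite -e /coframe; move: (frame i t) (connection_along i t) (gram_along i t).
by move=> F C G; rewrite linearN /= trmx_mul mulmxN mulmxDl !mulmxA addrK.
Qed.

Lemma connection_coframe i t : dom i (x t) ->
  connection_along i t *m coframe i t = koszul_along i t *m (frame i t)^T.
Proof. by move=> it; rewrite mulmxA connection_koszul. Qed.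

Lemma coframe_der_cont i t : t \in `[0, tau] -> dom i (x t) ->
  cont_in tau (fun s => connection_along i s *m coframe i s) t.
Proof.
move=> tI it.
have c := cont_in_mulmx (koszul_along_cont x_C2 tI it)
  (cont_in_trmx (has_der_continuous (frame_has_der tI it))).
apply: (cont_in_near tI _ c).
apply: filterS (times_near x_C2 tI it) => s si ss.
by rewrite connection_coframe //; exact: si.
Qed.

(** Inserting coframe times frame on the right isolates the factor connection times coframe, whose
    continuity is known through the Koszul matrix. *)
Lemma frame_der_cont i t : t \in `[0, tau] -> dom i (x t) ->
  cont_in tau (fun s => - (frame i s *m connection_along i s)) t.
Proof.
move=> tI it; have cE := has_der_continuous (frame_has_der tI it).
have c := cont_in_opp (cont_in_mulmx (cont_in_mulmx cE (coframe_der_cont tI it)) cE).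
apply: (cont_in_near tI _ c).
apply: filterS (times_near x_C2 tI it) => s si ss.
rewrite -(mulmxA (frame i s)) -(mulmxA (connection_along i s)).
by rewrite (coframe_frame ss (si ss)) mulmx1.
Qed.

End parallel_frame.

(** * Covariant derivatives in the coordinates of the parallel frame *)

Section covariant_derivative_coordinates.
Context {R : realType} {M : surface R} (tau : R) (x : R -> M).
Hypotheses (tau_gt0 : 0 < tau) (x_C2 : Ck_curve tau 2 x).
Hypothesis x_unit : arc_length_param tau x.
Implicit Types (i j : chart_index M) (t : R).

Local Notation speed := (speed tau x).
Local Notation connection_along := (connection_along tau x).
Local Notation frame := (frame tau x).
Local Notation coframe := (coframe tau x).

Definition frame_field t : 'M[R]_2 := frame (chart_at (x t)) t.
Definition coframe_field t : 'M[R]_2 := coframe (chart_at (x t)) t.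

Lemma frame_coframe_field t : t \in `[0, tau] -> frame_field t *m coframe_field t = 1%:M.
Proof. by move=> tI; apply: frame_coframe => //; exact: dom_chart_at. Qed.

Lemma coframe_frame_field t : t \in `[0, tau] -> coframe_field t *m frame_field t = 1%:M.
Proof. by move=> tI; apply: coframe_frame => //; exact: dom_chart_at. Qed.

Lemma frame_components i t v : t \in `[0, tau] -> dom i (x t) ->
  components i (x t) (v *m frame_field t) = v *m frame i t.
Proof.
move=> tI it; rewrite /components -mulmxA; congr (_ *m _).
by apply/esym/(frame_change tau_gt0 x_C2 x_unit tI _ it); exact: dom_chart_at.
Qed.

Lemma coframe_components i t v : t \in `[0, tau] -> dom i (x t) ->
  v *m coframe_field t = components i (x t) v *m coframe i t.
Proof.
move=> tI it; rewrite /components -mulmxA; congr (_ *m _); apply/esym.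
by apply: (coframe_change tau_gt0 x_C2 x_unit tI _ it); exact: dom_chart_at.
Qed.

(* [y] need only agree with the C^2 curve [x] on [0, tau]: the foot point of a
   rolling along [x] is such a curve. *)
Variable y : R -> M.
Hypothesis y_x : forall t, t \in `[0, tau] -> y t = x t.

Lemma curve_agree i t : t \in `[0, tau] -> dom i (x t) ->
  has_der tau (chart i \o y) t (speed i t).
Proof.
move=> tI it; have h := chart_has_der x_C2 tI it.
by apply: (has_der_eq_in tI _ h) => s ss /=; rewrite y_x.
Qed.

Lemma differentiable_curve_agree t : t \in `[0, tau] -> differentiable_curve tau y t.
Proof.
move=> tI; rewrite /differentiable_curve y_x //.
by have [] := has_derE tau_gt0 tI (curve_agree tI (dom_chart_at (x t))).
Qed.

Lemma velocity_agree t : t \in `[0, tau] ->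
  velocity tau y t = direction (phase tau x t) *m frame_field t.
Proof.
move=> tI; rewrite /velocity (y_x tI).
have [_ ->] := has_derE tau_gt0 tI (curve_agree tI (dom_chart_at (x t))).
exact: speed_frame.
Qed.

(** With [W] the coframe and [C] the connection, [(Z W)' = Z' W + Z C W]: differentiating the
    coframe supplies exactly the Christoffel term. *)
Lemma covariant_derivative_coordinates (Z : R -> 'rV[R]_2) t : t \in `[0, tau] ->
  covariantly_derivable tau y Z t ->
  has_der tau (fun s => Z s *m coframe_field s) t
    (covariant_derivative tau y Z t *m coframe_field t).
Proof.
move=> tI [_]; have jt := dom_chart_at (x t); set j := chart_at (x t) in jt.
rewrite /covariant_derivative y_x // -/j => /derivable_inP hZ.
set z' := der _ _ _ in hZ *.
have hW := coframe_has_der tau_gt0 x_C2 x_unit tI jt.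
have h := has_der_mulmx hZ hW.
have e : \forall s \near t, s \in `[0, tau] ->
    components j (y s) (Z s) *m coframe j s = Z s *m coframe_field s.
  apply: filterS (times_near x_C2 tI jt) => s sj ss; rewrite (y_x ss).
  by rewrite (coframe_components _ ss (sj ss)).
have {}h := has_der_near_eq tI e h.
rewrite christoffel_formE mulmxDl.
have vE : velocity tau y t = speed j t.
  rewrite /velocity (y_x tI).
  by have [_] := has_derE tau_gt0 tI (curve_agree tI jt).
have cE : components j (y t) (Z t) = Z t.
  by rewrite /components (y_x tI) transition_refl ?mulmx1.
rewrite cE in h; rewrite vE -mulmxA; exact: h.
Qed.

Lemma frame_field_derivable (c : 'rV[R]_2) (Z : R -> 'rV[R]_2) t :
  (forall s, s \in `[0, tau] -> Z s = c *m frame_field s) -> t \in `[0, tau] ->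
  covariantly_derivable tau y Z t /\ covariant_derivative tau y Z t = 0.
Proof.
move=> ZE tI; have jt := dom_chart_at (x t).
have hE := has_der_mulmxl c (frame_has_der tau_gt0 x_C2 x_unit tI jt).
have e : \forall s \near t, s \in `[0, tau] ->
    c *m frame (chart_at (x t)) s = components (chart_at (x t)) (y s) (Z s).
  apply: filterS (times_near x_C2 tI jt) => s sj ss; rewrite y_x // ZE //.
  by rewrite (frame_components _ ss (sj ss)).
have [d1 d2] := has_derE tau_gt0 tI (has_der_near_eq tI e hE).
have cd : covariantly_derivable tau y Z t.
  by split; [exact: differentiable_curve_agree|rewrite y_x].
split => //; rewrite /covariant_derivative y_x // d2 christoffel_formE.
have -> : velocity tau y t = speed (chart_at (x t)) t.
  rewrite /velocity (y_x tI).
  by have [_] := has_derE tau_gt0 tI (curve_agree tI jt).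
by rewrite ZE // mulmxN -mulmxA addNr.
Qed.

Lemma times_sub i t : t \in `[0, tau] -> dom i (x t) ->
  exists2 r : R, 0 < r & forall a b, 0 <= a -> a <= t -> t <= b -> b <= tau ->
    t - a < r -> b - t < r ->
    forall s, a <= s -> s <= b -> s \in `[0, tau] /\ dom i (x s).
Proof.
move=> tI it; have /nbhs_ballP[r /= r0 rP] := times_near x_C2 tI it.
exists r => // a b a0 at_ tb bt ta bt' s as_ sb.
have sI : s \in `[0, tau] by rewrite in_itv /= (le_trans a0 as_) (le_trans sb bt).
split => //; apply: rP => //; rewrite /ball /= ltr_norml.
by apply/andP; split; lra.
Qed.

Lemma coframe_abs_cont i a b : 0 <= a -> a <= b -> b <= tau ->
  (forall s, a <= s -> s <= b -> s \in `[0, tau] /\ dom i (x s)) ->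
  abs_cont a b (coframe i).
Proof.
move=> a0 ab bt h.
apply: (abs_cont_C1 (d := fun s => connection_along i s *m coframe i s) a0 ab bt)
  => s as_ sb;
  have [sI si] := h s as_ sb.
  exact: coframe_has_der.
exact: coframe_der_cont.
Qed.

Lemma frame_abs_cont i a b : 0 <= a -> a <= b -> b <= tau ->
  (forall s, a <= s -> s <= b -> s \in `[0, tau] /\ dom i (x s)) ->
  abs_cont a b (frame i).
Proof.
move=> a0 ab bt h.
apply: (abs_cont_C1 (d := fun s => - (frame i s *m connection_along i s)) a0 ab bt)
  => s as_ sb;
  have [sI si] := h s as_ sb.
  exact: frame_has_der.
exact: frame_der_cont.
Qed.

Lemma abs_cont_eq_in (V : normedModType R) (f g : R -> V) a b :
  (forall s, a <= s -> s <= b -> f s = g s) -> abs_cont a b f -> abs_cont a b g.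
Proof.
move=> fg; apply: (@abs_cont_le _ _ _ _ _ _ _ 1) => // s t as_ st tb.
by rewrite mul1r !fg //; [exact: le_trans tb|exact: le_trans st].
Qed.

Lemma abs_cont_row_mx m n1 n2 (f : R -> 'M[R]_(m, n1)) (g : R -> 'M[R]_(m, n2)) a b :
  abs_cont a b f -> abs_cont a b g ->
  abs_cont a b (fun s => row_mx (f s) (g s)).
Proof.
apply: (@abs_cont_le2 _ _ _ _ _ _ _ _ _ 1) => // s t _ _ _; rewrite mul1r.
rewrite opp_row_mx add_row_mx mx_norm_leP ?addr_ge0 // => i j.
rewrite mxE; case: splitP => k _.
  have := lexx `|f t - f s|; rewrite [X in X -> _]mx_norm_leP // => /(_ i k).
  by move/le_trans; apply; rewrite lerDl.
have := lexx `|g t - g s|; rewrite [X in X -> _]mx_norm_leP // => /(_ i k).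
by move/le_trans; apply; rewrite lerDr.
Qed.

Lemma abs_cont_rsubmx m n1 n2 (f : R -> 'M[R]_(m, n1)) (g : R -> 'M[R]_(m, n2)) a b :
  abs_cont a b (fun s => row_mx (f s) (g s)) -> abs_cont a b g.
Proof.
apply: (@abs_cont_le _ _ _ _ _ _ _ 1) => // s t _ _ _; rewrite mul1r.
rewrite opp_row_mx add_row_mx mx_norm_leP // => i j.
have := lexx `|row_mx (f t - f s) (g t - g s)|.
by rewrite [X in X -> _]mx_norm_leP // => /(_ i (rshift n1 j)); rewrite row_mxEr.
Qed.

Lemma field_abs_cont (Z : R -> 'rV[R]_2) i a b :
  abs_cont_field tau y Z -> 0 <= a -> a <= b -> b <= tau ->
  (forall s, a <= s -> s <= b -> s \in `[0, tau] /\ dom i (x s)) ->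
  abs_cont a b (fun s => components i (x s) (Z s)).
Proof.
move=> Zac a0 ab bt h; have hs : `[a, b] `<=` times tau
    (fun (i : chart_index M) (xv : M * 'rV[R]_2) => dom i xv.1) (fun t => (y t, Z t)) i.
  move=> s /=; rewrite in_itv /= => /andP[as_ sb]; have [sI si] := h s as_ sb.
  by split => //=; rewrite y_x.
have := abs_cont_rsubmx (Zac i a b hs).
apply: abs_cont_eq_in => s as_ sb; have [sI _] := h s as_ sb.
by rewrite /= y_x.
Qed.

Lemma frame_field_abs_cont (c : 'rV[R]_2) (Z : R -> 'rV[R]_2) :
  (forall s, s \in `[0, tau] -> Z s = c *m frame_field s) -> abs_cont_field tau y Z.
Proof.
(* If [b < a], the hypothesis on [[a, b]] is vacuous, but then the empty family of subintervals is
   the only admissible one. *)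
move=> ZE i a b hab; have [ba|ab] := ltP b a.
  move=> e e0; exists 1 => // s sall _ _.
  rewrite big_seq big1 // => I Is; have /allP/(_ I Is)/and3P[h1 h2 h3] := sall.
  by move: (lt_le_trans ba (le_trans h1 (le_trans h2 h3))); rewrite ltxx.
have hs s : a <= s -> s <= b -> s \in `[0, tau] /\ dom i (x s).
  move=> as_ sb; have [|sI /= si] := hab s; first by rewrite /= in_itv /= as_ sb.
  by split => //; rewrite -y_x.
have [aI _] := hs a (lexx _) ab; have [bI _] := hs b ab (lexx _).
move: aI bI; rewrite !in_itv /= => /andP[a0 _] /andP[_ bt].
apply: (@abs_cont_eq_in _ (fun s => row_mx (chart i (x s)) (c *m frame i s))).
  move=> s as_ sb; have [sI si] := hs s as_ sb.
  by rewrite /= y_x // ZE // (frame_components _ sI si).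
apply: abs_cont_row_mx.
  apply: (abs_cont_C1 (d := speed i) a0 ab bt) => s as_ sb; have [sI si] := hs s as_ sb.
    exact: chart_has_der.
  exact: speed_cont.
apply: (abs_cont_C1 (d := fun s => c *m - (frame i s *m connection_along i s)) a0 ab bt)
  => s as_ sb; have [sI si] := hs s as_ sb.
  by apply: has_der_mulmxl; exact: frame_has_der.
by apply: cont_in_mulmx; [exact: cont_in_cst|exact: frame_der_cont].
Qed.

Lemma field_coframe_locally_abs_cont (Z : R -> 'rV[R]_2) k :
  abs_cont_field tau y Z ->
  locally_abs_cont tau (fun s => (Z s *m coframe_field s) 0 k).
Proof.
move=> Zac t tI; have jt := dom_chart_at (x t).
have [r r0 rP] := times_sub tI jt; exists r => // a b a0 at_ tb bt ta bt'.
have hs := rP a b a0 at_ tb bt ta bt'; have ab := le_trans at_ tb.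
have := abs_cont_mulmx_coord 0 k ab (field_abs_cont Zac a0 ab bt hs)
  (coframe_abs_cont a0 ab bt hs).
apply: abs_cont_eq_in => s as_ sb; have [sI si] := hs s as_ sb.
by rewrite (coframe_components _ sI si).
Qed.

End covariant_derivative_coordinates.

(** * Rollings *)

Lemma ae_impl (R : realType) (P Q : R -> Prop) :
  {ae lebesgue_measure, forall t : R, P t} -> (forall t, P t -> Q t) ->
  {ae lebesgue_measure, forall t : R, Q t}.
Proof.
move=> [N [mN N0 h]] PQ; exists N; split=> // t nQ.
by apply: h => /= Pt; exact/nQ/PQ.
Qed.

Section plane_geometry.
Context {R : realType}.

Lemma plane_components (i : chart_index (plane R)) (p : plane R) (v : 'rV[R]_2) :
  components i p v = v.
Proof.
case: i; rewrite /components (_ : chart_at p = tt) //.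
by rewrite (@transition_refl _ _ (plane R) tt p) // mulmx1.
Qed.

Lemma plane_christoffel_form (i : chart_index (plane R)) p (v w : 'rV[R]_2) :
  christoffel_form i p v w = 0.
Proof.
have d0 a b c : dmetric i a b c p = 0 by exact: derive_cst.
apply/rowP => k; rewrite !mxE big1 // => a _; rewrite big1 // => b _.
rewrite /christoffel big1 ?mulr0 ?mul0r // => l _.
by rewrite !d0 addr0 subrr mulr0.
Qed.

Lemma plane_covariantly_derivable (tau : R) (y : R -> plane R)
    (Z : R -> 'rV[R]_2) t :
  covariantly_derivable tau y Z t <->
  differentiable_curve tau y t /\ derivable_in tau Z t.
Proof.
rewrite /covariantly_derivable.
rewrite (_ : (fun s => components _ (y s) (Z s)) = Z) //.
by apply/funext => s; exact: plane_components.
Qed.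

Lemma plane_covariant_derivative (tau : R) (y : R -> plane R)
    (Z : R -> 'rV[R]_2) t : covariant_derivative tau y Z t = der tau Z t.
Proof.
rewrite /covariant_derivative plane_christoffel_form addr0.
rewrite (_ : (fun s => components _ (y s) (Z s)) = Z) //.
by apply/funext => s; exact: plane_components.
Qed.

Lemma configuration_eq n (M N : riemannian R n) (c c' : configuration M N) :
  foot c = foot c' -> foot' c = foot' c' -> iso c = iso c' -> c = c'.
Proof.
case: c => f f' A h d; case: c' => g g' B h' d' /= e1 e2 e3.
by subst; rewrite (Prop_irrelevance h h') (Prop_irrelevance d d').
Qed.

End plane_geometry.

Section rolling_along_curve.
Context {R : realType} {M : surface R} (tau : R) (x : R -> M).
Hypotheses (tau_gt0 : 0 < tau) (x_C2 : Ck_curve tau 2 x).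
Hypothesis x_unit : arc_length_param tau x.
Implicit Types (i j : chart_index M) (t : R).

Local Notation frame_field := (frame_field tau x).
Local Notation coframe_field := (coframe_field tau x).
Local Notation phase := (phase tau x).

Let I0 : (0 : R) \in `[0, tau]. Proof. by rewrite in_itv /= lexx ltW. Qed.
Let Itau : tau \in `[0, tau]. Proof. by rewrite in_itv /= lexx ltW. Qed.

Lemma parallel_field_frame (Z : R -> 'rV[R]_2) t : t \in `[0, tau] ->
  parallel_field tau x Z -> Z t = Z 0 *m coframe_field 0 *m frame_field t.
Proof.
move=> tI [Zac Zpar].
have e : Z t *m coframe_field t = Z 0 *m coframe_field 0.
  apply/rowP => k.
  apply: (locally_abs_cont_const (h := fun s => (Z s *m coframe_field s) 0 k) tI).
    by apply: (field_coframe_locally_abs_cont tau_gt0 x_C2 x_unit (y := x)).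
  apply: ae_impl Zpar _ => s h sI; have [cd c0] := h sI.
  have := covariant_derivative_coordinates tau_gt0 x_C2 x_unit (fun _ _ => erefl) sI cd.
  by rewrite c0 mul0mx => /has_der_mxP /(_ 0 k); rewrite mxE.
by rewrite -e -mulmxA coframe_frame_field // mulmx1.
Qed.

Lemma frame_parallel (c : 'rV[R]_2) :
  parallel_field tau x (fun s => c *m frame_field s).
Proof.
split; first exact: (frame_field_abs_cont tau_gt0 x_C2 x_unit (y := x) _ (c := c)).
apply: aeW => t tI.
exact: (frame_field_derivable tau_gt0 x_C2 x_unit (y := x) _ (c := c)).
Qed.

(** An equality of matrices: it compares two frames of one tangent space once [x 0 = x tau], since
    both are then read in the same chart. *)
Lemma trivial_holonomyP :
  trivial_holonomy tau x <-> frame_field tau = frame_field 0.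
Proof.
split=> [h|h v w].
  apply/row_matrixP => k; rewrite !rowE.
  apply: (proj1 (h (delta_mx 0 k *m frame_field 0) _)).
  by exists (fun s => delta_mx 0 k *m frame_field s); split => //; exact: frame_parallel.
split=> [[Z [Zpar Z0 Zt]]|->].
  rewrite -Zt (parallel_field_frame Itau Zpar) h -mulmxA coframe_frame_field //.
  by rewrite mulmx1.
exists (fun s => v *m coframe_field 0 *m frame_field s); split.
- exact: frame_parallel.
- by rewrite -mulmxA coframe_frame_field // mulmx1.
- by rewrite h -mulmxA coframe_frame_field // mulmx1.
Qed.

(* The integral of [exp (i * phase)] in condition (b), as a curve in the plane. *)
Definition development t : 'rV[R]_2 :=
  \row_k \int[lebesgue_measure]_(s in `[0, t]) direction (phase s) 0 k.

Lemma direction_phase_cont t : t \in `[0, tau] ->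
  cont_in tau (fun s => direction (phase s)) t.
Proof.
move=> tI; have pc := has_der_continuous (phase_has_der tau_gt0 x_C2 x_unit tI).
have cc : cont_in tau (cos \o phase) t by apply: cont_in_comp pc; exact: continuous_cos.
have sc : cont_in tau (sin \o phase) t by apply: cont_in_comp pc; exact: continuous_sin.
apply/cont_in_mxP => a k.
rewrite (_ : (fun s => _) = if k == 0 then cos \o phase else sin \o phase).
  by case: (k == 0).
by apply/funext => s; rewrite mxE; case: (k == 0).
Qed.

Lemma development_has_der t : t \in `[0, tau] ->
  has_der tau development t (direction (phase t)).
Proof.
move=> tI; apply/has_der_mxP => a k; rewrite (ord1 a).
rewrite (_ : (fun s => _) = fun s => \int[lebesgue_measure]_(r in `[0, s])
  direction (phase r) 0 k); last by apply/funext => s; rewrite mxE.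
apply: has_der_primitive => // s sI.
by have /cont_in_mxP/(_ 0 k) := direction_phase_cont sI.
Qed.

Lemma development0 : development 0 = 0.
Proof. by apply/rowP => k; rewrite !mxE set_itv1 Rintegral_set1. Qed.

Lemma closed_developmentP :
  complex_integral 0 tau (fun t => expi (phase t)) = 0 <-> development tau = 0.
Proof.
have e0 : development tau 0 0 =
    \int[lebesgue_measure]_(t in `[0, tau]) complex.Re (expi (phase t)).
  by rewrite mxE; apply: eq_Rintegral => s _; rewrite mxE.
have e1 : development tau 0 1 =
    \int[lebesgue_measure]_(t in `[0, tau]) complex.Im (expi (phase t)).
  by rewrite mxE; apply: eq_Rintegral => s _; rewrite mxE.
rewrite /complex_integral -e0 -e1; split=> [[h0 h1]|h].
  by apply/rowP => k; case: (ord2P k) => ->; rewrite [RHS]mxE.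
by rewrite h !mxE.
Qed.

Section given_rolling.
Variable q : R -> configuration M (plane R).
Hypothesis q_rolling : rolling_along tau x q.

Let y_x t : t \in `[0, tau] -> foot (q t) = x t.
Proof. by case: q_rolling => _; exact. Qed.

(** The initial value of the matrix [C] of the rolled frame. It will be cancelled from equations by
    its invertibility, which follows from positive determinants. *)
Definition rolling_rotation : 'M[R]_2 := frame_field 0 *m iso (q 0).

Lemma rolling_rotation_unit : rolling_rotation \in unitmx.
Proof.
rewrite unitmx_mul !unitmxE !unitfE !gt_eqF ?iso_oriented //.
by apply: frame_det => //; exact: dom_chart_at.
Qed.

Lemma rolling_times i a b :
  (forall s, a <= s -> s <= b -> s \in `[0, tau] /\ dom i (x s)) ->
  `[a, b] `<=` times tau (@conf_dom R 2 M (plane R)) q (i, tt).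
Proof.
move=> h s /=; rewrite in_itv /= => /andP[as_ sb]; have [sI si] := h s as_ sb.
by split => //; split => //=; rewrite y_x.
Qed.

Lemma rolling_iso t : t \in `[0, tau] -> frame_field t *m iso (q t) = rolling_rotation.
Proof.
move=> tI; have [[[_ qac] _ notwist] _] := q_rolling.
apply/matrixP => a b.
apply: (locally_abs_cont_const (h := fun s => (frame_field s *m iso (q s)) a b) tI).
  move=> {t}t {}tI; have jt := dom_chart_at (x t).
  have [r r0 rP] := times_sub x_C2 tI jt; exists r => // c d c0 ct td dt tc dt'.
  have hs := rP c d c0 ct td dt tc dt'; have cd := le_trans ct td.
  have ac := qac _ c d (rolling_times hs).
  have {}ac : abs_cont c d
      (fun s => (conf_coord (chart_at (x t), tt : chart_index (plane R)) (q s)).2).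
    apply: (@abs_cont_le _ _ _ _ _ _ _ 1) ac => // s s' _ _ _.
    by rewrite mul1r prod_normE le_max lexx orbT.
  (* In a fixed chart both factors are absolutely continuous; the Jacobian contained in the bundle
     coordinate turns their product into the chart-free [frame_field s *m iso (q s)]. *)
  have := abs_cont_mulmx_coord a b cd
    (frame_abs_cont tau_gt0 x_C2 x_unit c0 cd dt hs) ac.
  apply: abs_cont_eq_in => s cs sd; have [sI si] := hs s cs sd.
  rewrite /= (_ : @transition R 2 (plane R) _ _ _ = 1%:M); last first.
    exact: (@transition_refl _ _ (plane R) tt).
  rewrite mulmx1 mulmxA y_x //.
  by rewrite -(frame_change tau_gt0 x_C2 x_unit sI si) //; exact: dom_chart_at.
(* No twist is applied to the [a]-th vector of the parallel frame. Its image in the plane is row [a]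
   of the matrix in question, so that row has zero derivative almost everywhere. *)
have Zac := frame_field_abs_cont tau_gt0 x_C2 x_unit y_x
  (c := delta_mx 0 a) (fun s _ => erefl).
apply: ae_impl (notwist _ Zac) _ => s h sI.
have [cd c0] := frame_field_derivable tau_gt0 x_C2 x_unit y_x
  (c := delta_mx 0 a) (fun s _ => erefl) sI.
have [/plane_covariantly_derivable[_ /derivable_inP hd]] := h sI cd.
rewrite c0 mul0mx plane_covariant_derivative => e; rewrite -e in hd.
move/has_der_mxP: hd => /(_ 0 b); rewrite mxE.
apply: has_der_eq_in => // r _.
by rewrite -mulmxA -rowE mxE.
Qed.

Lemma rolling_iso_coframe t : t \in `[0, tau] ->
  iso (q t) = coframe_field t *m rolling_rotation.
Proof.
by move=> tI; rewrite -(rolling_iso tI) mulmxA coframe_frame_field // mul1mx.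
Qed.

Lemma rolling_foot' t : t \in `[0, tau] ->
  foot' (q t) = (foot' (q 0) : 'rV[R]_2) + development t *m rolling_rotation.
Proof.
move=> tI; have [[[_ qac] noslip _] _] := q_rolling.
(* Subtracting the candidate reduces the claim to constancy: no slip gives the contact point the
   velocity [direction (phase s) *m rolling_rotation], which is also that of the candidate. *)
pose h s : 'rV[R]_2 := (foot' (q s) : 'rV[R]_2) + development s *m - rolling_rotation.
suff e : h t = h 0.
  move: e; rewrite /h development0 mul0mx addr0 => <-.
  by rewrite mulmxN addrNK.
apply/rowP => k.
apply: (locally_abs_cont_const (h := fun s => h s 0 k) tI).
  move=> {t}t {}tI; have jt := dom_chart_at (x t).
  have [r r0 rP] := times_sub x_C2 tI jt; exists r => // c d c0 ct td dt tc dt'.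
  have hs := rP c d c0 ct td dt tc dt'; have cd := le_trans ct td.
  have ac := qac _ c d (rolling_times hs).
  have {}ac : abs_cont c d (fun s => foot' (q s) : 'rV[R]_2).
    apply: (@abs_cont_le _ _ _ _ _ _ _ 1) ac => // s s' _ _ _.
    by rewrite mul1r prod_normE le_max prod_normE le_max lexx orbT.
  apply: abs_cont_coord; apply: abs_contD ac _.
  apply: (abs_cont_C1 (d := fun s => direction (phase s) *m - rolling_rotation) c0 cd dt)
    => s cs sd; have [sI si] := hs s cs sd.
    by apply: has_der_mulmxr; exact: development_has_der.
  by apply: cont_in_mulmx; [exact: direction_phase_cont|exact: cont_in_cst].
apply: ae_impl noslip _ => s hsl sI; have [_ dx' vE] := hsl sI.
have hd : has_der tau (fun s => foot' (q s) : 'rV[R]_2) s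
    (direction (phase s) *m rolling_rotation).
  rewrite -(rolling_iso sI) mulmxA -(velocity_agree tau_gt0 x_C2 y_x sI) -vE.
  exact: derivable_inP.
have hD := has_der_mulmxr (- rolling_rotation) (development_has_der sI).
have := has_derD hd hD; rewrite mulmxN subrr => /has_der_mxP /(_ 0 k).
by rewrite mxE.
Qed.

Lemma rolling_loopP : q 0 = q tau <->
  [/\ x 0 = x tau, frame_field tau = frame_field 0 & development tau = 0].
Proof.
have uC := rolling_rotation_unit.
split=> [e|[e1 e2 e3]].
  have e1 : x 0 = x tau by rewrite -!y_x // e.
  split => //.
    have eW := can_inj (mulmxK uC) (etrans (esym (rolling_iso_coframe I0))
      (etrans (congr1 (@iso _ _ _ _) e) (rolling_iso_coframe Itau))).
    rewrite -[LHS]mul1mx -(frame_coframe_field tau_gt0 x_C2 x_unit I0) eW -mulmxA.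
    by rewrite coframe_frame_field // mulmx1.
  have := rolling_foot' Itau; rewrite -e => /eqP.
  rewrite -subr_eq0 opprD addrA subrr add0r oppr_eq0 => /eqP.
  by move=> /(congr1 (mulmx^~ (invmx rolling_rotation))); rewrite /= mulmxK // mul0mx.
apply: configuration_eq.
- by rewrite !y_x.
- by rewrite (rolling_foot' Itau) e3 mul0mx addr0.
- apply: etrans (rolling_iso_coframe I0) (etrans _ (esym (rolling_iso_coframe Itau))).
  apply: (congr1 (mulmx^~ rolling_rotation)).
  rewrite -[LHS]mulmx1 -(frame_coframe_field tau_gt0 x_C2 x_unit Itau) e2 mulmxA.
  by rewrite coframe_frame_field // mul1mx.
Qed.

End given_rolling.

End rolling_along_curve.

Lemma cont_in_inside (R : realType) (tau : R) (T : topologicalType) (h : R -> T) :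
  {within `[0, tau], continuous h} <-> (forall t, t \in `[0, tau] -> cont_in tau h t).
Proof. by rewrite subspace_continuousP; split=> h' t; exact: h'. Qed.

Lemma cos_sin_period (R : realType) (a : R) :
  cos a = 1 /\ sin a = 0 <-> exists m : int, a = m%:~R * (2 * pi).
Proof.
have two : 2 * pi = pi *+ 2 :> R by rewrite mulr_natl.
have per (n : nat) : cos (n%:R * (2 * pi) : R) = 1 /\ sin (n%:R * (2 * pi) : R) = 0.
  elim: n => [|n [c s]]; first by rewrite mul0r cos0 sin0.
  by rewrite -natr1 mulrDl mul1r two cosD2pi sinD2pi -two c s.
have perz (m : int) : cos (m%:~R * (2 * pi) : R) = 1 /\ sin (m%:~R * (2 * pi) : R) = 0.
  case: m => n; first exact: per.
  have [c s] := per n.+1; rewrite NegzE mulrNz mulNr cosN sinN.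
  by rewrite -pmulrn c s oppr0.
split=> [[c s]|[m ->]]; last exact: perz.
have p0 : 0 < 2 * pi :> R by rewrite mulr_gt0 // pi_gt0.
(* Full turns are removed to land in [[0, 2 pi[]. There the half angle lies in [[0, pi[], where the
   sine vanishes only at 0, while [cos th = 1] forces [sin (th / 2) = 0]. *)
pose m : int := Num.floor (a / (2 * pi)); exists m.
have [cm sm] := perz m.
pose th := a - m%:~R * (2 * pi).
have ct : cos th = 1 by rewrite /th cosB c s cm sm mulr1 mulr0 addr0.
have th0 : 0 <= th.
  by rewrite subr_ge0 -ler_pdivlMr //; exact: floor_le.
have th1 : th < 2 * pi.
  rewrite ltrBlDl -{2}[2 * pi]mul1r -mulrDl -ltr_pdivrMr //.
  by have := floorD1_gt (a / (2 * pi)); rewrite intrD.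
have hs : sin (th / 2) = 0.
  have e : cos th = 1 - 2 * sin (th / 2) ^+ 2.
    rewrite {1}[th]splitr cosD; have := cos2Dsin2 (th / 2).
    by rewrite !expr2 => h; lra.
  have : sin (th / 2) ^+ 2 = 0 by lra.
  by move/eqP; rewrite expf_eq0 /= => /eqP.
have [t0|t0] := leP th 0.
  have e : th = 0 by apply/le_anti; rewrite t0 th0.
  by move/eqP: e; rewrite subr_eq0 => /eqP.
have : 0 < sin (th / 2).
  apply: sin_gt0_pi; rewrite divr_gt0 //= ltr_pdivrMr // mulrC; exact: th1.
by rewrite hs ltxx.
Qed.

(** * Rollings from explicit formulas, and their closing up to first order *)

Section rolling_loops.
Context {R : realType} {M : surface R} (tau : R) (x : R -> M).
Hypotheses (tau_gt0 : 0 < tau) (x_C2 : Ck_curve tau 2 x).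
Hypothesis x_unit : arc_length_param tau x.
Implicit Types (i j : chart_index M) (t : R).

Local Notation frame_field := (frame_field tau x).
Local Notation coframe_field := (coframe_field tau x).
Local Notation phase := (phase tau x).
Local Notation development := (development tau x).
Local Notation speed := (speed tau x).
Local Notation connection_along := (connection_along tau x).
Local Notation coframe := (coframe tau x).

Let I0 : (0 : R) \in `[0, tau]. Proof. by rewrite in_itv /= lexx ltW. Qed.
Let Itau : tau \in `[0, tau]. Proof. by rewrite in_itv /= lexx ltW. Qed.

Section explicit_rolling.
Variables (q : R -> configuration M (plane R)) (p0 : 'rV[R]_2) (C : 'M[R]_2).
Hypothesis qx : forall t, t \in `[0, tau] -> foot (q t) = x t.
Hypothesis qx' : forall t, t \in `[0, tau] ->
  foot' (q t) = p0 + development t *m C.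
Hypothesis qiso : forall t, t \in `[0, tau] -> iso (q t) = coframe_field t *m C.

Definition explicit_der i t : 'rV[R]_2 * 'rV[R]_2 * 'M[R]_2 :=
  (speed i t, direction (phase t) *m C, connection_along i t *m coframe i t *m C).

Lemma explicit_foot'_has_der t : t \in `[0, tau] ->
  has_der tau (fun s => foot' (q s) : 'rV[R]_2) t (direction (phase t) *m C).
Proof.
move=> tI; have h := has_der_mulmxr C (development_has_der tau_gt0 x_C2 x_unit tI).
have := has_derD (has_der_cst tau p0 t) h; rewrite add0r.
by apply: has_der_eq_in => // s sI; rewrite qx'.
Qed.

Lemma explicit_has_der i (k : chart_index (plane R)) t :
  t \in `[0, tau] -> dom i (x t) ->
  has_der tau (conf_coord (i, k) \o q) t (explicit_der i t).
Proof.
move=> tI it; have h1 := chart_has_der x_C2 tI it.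
have h2 := explicit_foot'_has_der tI.
have h3 := has_der_mulmxr C (coframe_has_der tau_gt0 x_C2 x_unit tI it).
have := has_der_pair (has_der_pair h1 h2) h3; apply: has_der_near_eq => //.
apply: filterS (times_near x_C2 tI it) => s si ss /=.
rewrite /conf_coord /= qx //; congr (_, _).
rewrite (_ : @transition R 2 (plane R) _ _ _ = 1%:M); last first.
  by case: k; exact: (@transition_refl _ _ (plane R) tt).
rewrite mulmx1 qiso // mulmxA; congr (_ *m _).
have jt := dom_chart_at (x s).
by rewrite (coframe_change tau_gt0 x_C2 x_unit ss (si ss) jt).
Qed.

Lemma explicit_der_cont i t : t \in `[0, tau] -> dom i (x t) ->
  cont_in tau (explicit_der i) t.
Proof.
move=> tI it; have c1 := speed_cont x_C2 tI it.
have cC := @cont_in_cst R tau _ C t.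
have c2 := cont_in_mulmx (direction_phase_cont tau_gt0 x_C2 x_unit tI) cC.
have c3 := cont_in_mulmx (coframe_der_cont tau_gt0 x_C2 x_unit tI it) cC.
exact: cont_in_pair (cont_in_pair c1 c2) c3.
Qed.

Lemma explicit_feet : continuous_feet tau q.
Proof.
split; apply/cont_in_inside => t tI.
  apply: (cont_in_near tI _ (curve_cont_in x_C2 tI)).
  by near=> s => sI; rewrite qx.
exact: has_der_continuous (explicit_foot'_has_der tI).
Unshelve. all: by end_near. Qed.

(** Every rolling along [x] satisfies the three formulas assumed here, so its regularity improves
    from absolutely continuous to C^1. The same formulas serve to construct a rolling. *)
Lemma explicit_C1 : C1_configuration tau q.
Proof.
split; first exact: explicit_feet.
case=> i k; set D := times _ _ _ _.
have Dx t : D t -> t \in `[0, tau] /\ dom i (x t).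
  by move=> [tI [/= h _]]; split => //; rewrite -qx.
split=> [t /Dx[tI it]|].
  by have [] := has_derE tau_gt0 tI (explicit_has_der k tI it).
have Dsub : D `<=` `[0, tau] by move=> t /Dx[].
have Dnear t : D t -> \forall s \near t, s \in `[0, tau] -> D s.
  move=> /Dx[tI it]; apply: filterS (times_near x_C2 tI it) => s si sI.
  by split => //; split; [rewrite /= qx //; exact: si|].
apply: (proj2 (cont_in_within _ Dsub Dnear)) => t Dt; have [tI it] := Dx t Dt.
apply: (cont_in_near tI _ (explicit_der_cont tI it)).
apply: filterS (times_near x_C2 tI it) => s si sI.
by have [_ ->] := has_derE tau_gt0 sI (explicit_has_der k sI (si sI)).
Qed.

Lemma explicit_abs_cont : abs_cont_configuration tau q.
Proof.
split; first exact: explicit_feet.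
case=> i k a b hab; have [ba|ab] := ltP b a.
  move=> e e0; exists 1 => // s sall _ _.
  rewrite big_seq big1 // => I Is; have /allP/(_ I Is)/and3P[h1 h2 h3] := sall.
  by move: (lt_le_trans ba (le_trans h1 (le_trans h2 h3))); rewrite ltxx.
have hs s : a <= s -> s <= b -> s \in `[0, tau] /\ dom i (x s).
  move=> as_ sb; have [|sI [/= si _]] := hab s; first by rewrite /= in_itv /= as_ sb.
  by split => //; rewrite -qx.
have [aI _] := hs a (lexx _) ab; have [bI _] := hs b ab (lexx _).
move: aI bI; rewrite !in_itv /= => /andP[a0 _] /andP[_ bt].
apply: (abs_cont_C1 (d := explicit_der i) a0 ab bt) => s as_ sb;
  have [sI si] := hs s as_ sb.
  exact: explicit_has_der.
exact: explicit_der_cont.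
Qed.

Lemma explicit_rolling_along : rolling_along tau x q.
Proof.
split => //; split; first exact: explicit_abs_cont.
  apply: aeW => t tI; have h := explicit_foot'_has_der tI.
  have [h1 h2] := has_derE tau_gt0 tI h; split.
  - exact: (differentiable_curve_agree tau_gt0 x_C2 qx tI).
  - exact: h1.
  - apply: etrans h2 _; rewrite (velocity_agree tau_gt0 x_C2 qx tI) qiso //.
    rewrite -mulmxA [frame_field t *m _]mulmxA.
    by rewrite (frame_coframe_field tau_gt0 x_C2 x_unit tI) mul1mx.
move=> Z Zac; apply: aeW => t tI Zt.
have h := covariant_derivative_coordinates tau_gt0 x_C2 x_unit qx tI Zt.
have {}h := has_der_mulmxr C h.
have hq : has_der tau (fun s => Z s *m iso (q s)) t
    (covariant_derivative tau (fun s => foot (q s)) Z t *m coframe_field t *m C).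
  by apply: (has_der_eq_in tI _ h) => s sI; rewrite qiso // mulmxA.
have [h1 h2] := has_derE tau_gt0 tI hq; split.
  apply/plane_covariantly_derivable; split; last exact: h1.
  exact: (proj1 (has_derE tau_gt0 tI (explicit_foot'_has_der tI))).
have h3 : covariant_derivative tau (fun s => foot' (q s))
    (fun s => Z s *m iso (q s)) t =
    covariant_derivative tau (fun s => foot (q s)) Z t *m coframe_field t *m C.
  by rewrite plane_covariant_derivative; exact: h2.
apply/esym; apply: etrans h3 _.
by rewrite -mulmxA; apply: (congr1 (mulmx _)); apply/esym; exact: qiso.
Qed.

End explicit_rolling.

Lemma rolling_exists :
  exists q : R -> configuration M (plane R), rolling_along tau x q.
Proof.
(* A configuration carries proofs of isometry and orientation at every real time, whereas the
   coframe is known to be orthonormal over [[0, tau]]; hence time is clamped to the segment. *)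
pose clamp (s : R) := Num.max 0 (Num.min s tau).
have cI s : clamp s \in `[0, tau].
  by rewrite in_itv /= le_max lexx ge_max (ltW tau_gt0) ge_min lexx orbT.
have cE s : s \in `[0, tau] -> clamp s = s.
  by rewrite in_itv /= => /andP[s0 st]; rewrite /clamp (min_idPl st) (max_idPr s0).
have EW t : t \in `[0, tau] -> frame_field t *m coframe_field t = 1%:M.
  exact: frame_coframe_field.
have isom t : t \in `[0, tau] ->
    coframe_field t *m gram (development t : plane R) *m (coframe_field t)^T = gram (x t).
  move=> tI; rewrite (_ : @gram R 2 (plane R) _ = 1%:M) // mulmx1.
  have jt := dom_chart_at (x t).
  have [h1 h2 _] := orthonormal_inv (frame_gram tau_gt0 x_C2 x_unit tI jt).
  rewrite {2}/coframe_field /coframe trmx_mul trmxK (gram_along_sym jt).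
  by rewrite mulmxA (coframe_frame tau_gt0 x_C2 x_unit tI jt) mul1mx.
have orient t : t \in `[0, tau] -> 0 < \det (coframe_field t).
  move=> tI; have := congr1 (@determinant _ _) (EW t tI).
  rewrite det_mulmx det1 => e.
  have d0 : 0 < \det (frame_field t).
    by apply: frame_det => //; exact: dom_chart_at.
  by rewrite -(pmulr_rgt0 _ d0) e.
exists (fun s => @Configuration R 2 M (plane R) (x (clamp s)) (development (clamp s))
  (coframe_field (clamp s)) (isom _ (cI s)) (orient _ (cI s))).
(* This is the rolling that starts at the origin of the plane with [C] the identity. *)
apply: (@explicit_rolling_along _ 0 1%:M) => t tI /=; rewrite cE //.
  by rewrite add0r mulmx1.
by rewrite mulmx1.
Qed.

Lemma rolling_C1_loopP (q : R -> configuration M (plane R)) :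
  rolling_along tau x q ->
  C1_loop tau q <->
  q 0 = q tau /\ exists m : int, phase tau = m%:~R * (2 * pi).
Proof.
move=> qr; have uC := rolling_rotation_unit tau_gt0 x_C2 x_unit q.
set C := rolling_rotation _ _ _ in uC.
have qx t : t \in `[0, tau] -> foot (q t) = x t by case: qr => _; exact.
have qx' := rolling_foot' tau_gt0 x_C2 x_unit qr.
have qiso := rolling_iso_coframe tau_gt0 x_C2 x_unit qr.
have hC1 := explicit_C1 qx qx' qiso.
have d00 : direction (phase 0) = delta_mx 0 0 :> 'rV[R]_2.
  rewrite phase0; apply/rowP => k; case: (ord2P k) => ->;
    by rewrite !mxE /= ?cos0 ?sin0.
have dirP : direction (phase tau) = direction (phase 0) <->
    exists m : int, phase tau = m%:~R * (2 * pi).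
  rewrite -cos_sin_period d00; split=> [/rowP h|[c s]].
    by have := h 0; have := h 1; rewrite !mxE /=.
  by apply/rowP => k; case: (ord2P k) => ->; rewrite !mxE /= ?c ?s.
have derE t i (k : chart_index (plane R)) : t \in `[0, tau] -> dom i (x t) ->
    der tau (conf_coord (i, k) \o q) t = explicit_der C i t.
  move=> tI it.
  by have [] := has_derE tau_gt0 tI (explicit_has_der qx qx' qiso k tI it).
pose i := chart_at (foot (q 0)); pose k := chart_at (foot' (q 0)).
have i0 : dom i (x 0) by rewrite -(qx _ I0); exact: dom_chart_at.
split=> [[_ e ed]|[e /dirP edir]].
  have it : dom i (x tau) by rewrite -(qx _ Itau) -e (qx _ I0).
  (* The velocity of the contact point in the plane is the component that isolates the phase: [C] is
     invertible, so equal velocities mean equal directions. *)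
  have e2 := congr1 (fun z => z.1.2)
    (etrans (esym (derE 0 i k I0 i0)) (etrans ed (derE tau i k Itau it))).
  split; first exact: e.
  have e3 : direction (phase 0) *m C = direction (phase tau) *m C by exact: e2.
  by apply/dirP; exact: (can_inj (mulmxK uC) (esym e3)).
split; [exact: hC1|exact: e|].
have [ex ef _] := proj1 (rolling_loopP tau_gt0 x_C2 x_unit qr) e.
have it : dom i (x tau) by rewrite -ex.
apply: etrans (derE 0 i k I0 i0) (etrans _ (esym (derE tau i k Itau it))).
(* Conversely, the derivative is a function of the point, the frame and the direction of the phase,
   and all three agree at 0 and [tau]. *)
rewrite /explicit_der edir.
have ii : i = chart_at (x 0) by rewrite /i (qx _ I0).
have eF : frame tau x i tau = frame tau x i 0.
  by rewrite ii; move: ef; rewrite /frame_field -ex.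
have eS : speed i tau = speed i 0 by rewrite !speed_frame eF edir.
have eW : coframe i tau = coframe i 0.
  by rewrite /coframe eF /gram_along -ex.
have eA : connection_along i tau = connection_along i 0.
  by rewrite /connection_along eS -ex.
by rewrite eS eW eA.
Qed.

End rolling_loops.


Theorem corollary2 (R : realType) (M : surface R) (tau : R) (x : R -> M)
    (tau_gt0 : 0 < tau) (x_C2 : Ck_curve tau 2 x)
    (x_arc_length : arc_length_param tau x) :
  let kg := geodesic_curvature tau x in
  let a := forall q : R -> configuration M (plane R),
    rolling_along tau x q -> q 0 = q tau in
  let b := [/\ x 0 = x tau, trivial_holonomy tau x &
    complex_integral 0 tau (fun t =>
      expi (\int[lebesgue_measure]_(s in `[0, t]) kg s)) = 0] in
  (a <-> b) /\
  (forall q : R -> configuration M (plane R), rolling_along tau x q ->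
    (C1_loop tau q <->
     b /\ exists m : int,
       \int[lebesgue_measure]_(t in `[0, tau]) kg t = m%:~R * (2 * pi))).
Proof.
move=> kg a b.
have hol := trivial_holonomyP tau_gt0 x_C2 x_arc_length.
have dev := @closed_developmentP R M tau x.
have bP : b <-> [/\ x 0 = x tau, frame_field tau x tau = frame_field tau x 0 &
    development tau x tau = 0].
  split=> [[h1 h2 h3]|[h1 h2 h3]].
    by split; [exact: h1|exact: (proj1 hol h2)|exact: (proj1 dev h3)].
  by split; [exact: h1|exact: (proj2 hol h2)|exact: (proj2 dev h3)].
have loopP (q : R -> configuration M (plane R)) (qr : rolling_along tau x q) :
    q 0 = q tau <-> b.
  have L := rolling_loopP tau_gt0 x_C2 x_arc_length qr.
  by split=> [/(proj1 L)/(proj2 bP)|/(proj1 bP)/(proj2 L)].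
split=> [|q qr].
  split=> [ha|hb q qr]; last exact: (proj2 (loopP q qr) hb).
  (* Condition (a) would hold vacuously if no rolling along [x] existed, so one must be produced to
     draw (b) from it. *)
  have [q qr] := rolling_exists tau_gt0 x_C2 x_arc_length.
  exact: (proj1 (loopP q qr) (ha q qr)).
have L := rolling_C1_loopP tau_gt0 x_C2 x_arc_length qr.
split=> [/(proj1 L)[e m]|[hb m]].
  by split; [exact: (proj1 (loopP q qr) e)|exact: m].
by apply: (proj2 L); split; [exact: (proj2 (loopP q qr) hb)|exact: m].
Qed.
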